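(* There is a fixed finite groupoid $G$ such that $\mathrm{LOGCFL}\subseteq Q_G\mathrm{FO}$.
   Context: Words over a finite ordered alphabet are viewed as finite structures with universe $\{1,\dots,n\}$, unary letter predicates $P_a$, linear order $<$, equality, constants min, max; FO denotes first-order logic over this signature (without BIT). Lindström quantifier: for a language $L$ over an ordered alphabet $(b_1,\dots,b_t)$, a $k$-tuple of variables $\bar x$ and formulas $\phi_1,\dots,\phi_{t-1}$, $Q_L\bar x[\phi_1,\dots,\phi_{t-1}]$ holds on a word $w$ of length $n$ iff the word of length $n^k$ whose $i$th letter (tuples $X_1,\dots,X_{n^k}$ in lexicographic order) is $b_j$ for the least $j$ with $w\models\phi_j(X_i)$, and $b_t$ if none, belongs to $L$ ($k$ arbitrary). A groupoid is a finite set $G$ with an arbitrary binary operation; for $S\subseteq G$, $\mathcal W(S,G)$ is the set of nonempty words over alphabet $G$ that evaluate to an element of $S$ under some legal bracketing. $Q_G\mathrm{FO}$ is the class of languages definable by applying a single quantifier $Q_L$ with $L=\mathcal W(S,G)$, $S\subseteq G$, to a tuple of FO formulas. LOGCFL is the class of languages logspace many-one reducible to a context-free language. *)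

(* Defs.v *)
From Stdlib Require Import Relation_Operators.
From mathcomp Require Import all_boot.

Set Implicit Arguments.
Unset Strict Implicit.
Unset Printing Implicit Defensive.

(* An alphabet is a [finType]; when an ordered alphabet is called for, the order
   is the one of the enumeration [enum T]. *)
Definition language (A : finType) := seq A -> Prop.

(** * First-order logic on words *)

(* [formula A m]: formulas whose free variables are among the m variables
   indexed by ['I_m].  A quantifier binds variable 0 of its body, and shifts the
   other ones by one. *)
Inductive term (m : nat) : Type :=
| Var of 'I_m
| Min
| Max.
Arguments Min {m}.
Arguments Max {m}.

Inductive formula (A : finType) : nat -> Type :=
| Letter m (a : A) (t : term m) : formula A m
| Less m (t1 t2 : term m) : formula A m
| Equal m (t1 t2 : term m) : formula A m
| Not m (phi : formula A m) : formula A m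
| And m (phi psi : formula A m) : formula A m
| Or m (phi psi : formula A m) : formula A m
| Exists m (phi : formula A m.+1) : formula A m
| Forall m (phi : formula A m.+1) : formula A m.

(* The structure of a word of length n.+1 has universe ['I_n.+1]: positions are
   numbered from 0.  The constants min and max require the word to be nonempty. *)
Definition term_val n m (v : m.-tuple 'I_n.+1) (t : term m) : 'I_n.+1 :=
  match t with
  | Var i => tnth v i
  | Min => ord0
  | Max => ord_max
  end.

Fixpoint sat (A : finType) n (w : n.+1.-tuple A) m (phi : formula A m) :
    m.-tuple 'I_n.+1 -> bool :=
  match phi in formula _ m return m.-tuple 'I_n.+1 -> bool with
  | Letter _ a t => fun v => tnth w (term_val v t) == a
  | Less _ t1 t2 => fun v => term_val v t1 < term_val v t2
  | Equal _ t1 t2 => fun v => term_val v t1 == term_val v t2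
  | Not _ phi => fun v => ~~ sat w phi v
  | And _ phi psi => fun v => sat w phi v && sat w psi v
  | Or _ phi psi => fun v => sat w phi v || sat w psi v
  | Exists _ phi => fun v => [exists x : 'I_n.+1, sat w phi [tuple of x :: v]]
  | Forall _ phi => fun v => [forall x : 'I_n.+1, sat w phi [tuple of x :: v]]
  end.

(** * Lindström quantifiers *)

(* All the k-tuples over ['I_n], in lexicographic order, the first component
   being the most significant one. *)
Fixpoint lex_tuples (n k : nat) : seq (k.-tuple 'I_n) :=
  match k return seq (k.-tuple 'I_n) with
  | 0 => [:: [tuple]]
  | k'.+1 => [seq [tuple of x :: X] |
                x : 'I_n <- enum 'I_n, X : k'.-tuple 'I_n <- lex_tuples n k']
  end.

(* The ordered alphabet (b_1, ..., b_t) is given as bs = (b_1, ..., b_(t-1)) and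
   b = b_t, to be used with [size phis = size bs]: [find] returns the least index
   of a formula that holds at X, and [size phis] (hence the letter b) if there is
   none. *)
Definition lindstrom_word (A T : finType) (bs : seq T) (b : T) (k : nat)
    (phis : seq (formula A k)) n (w : n.+1.-tuple A) : seq T :=
  [seq nth b bs (find (fun phi => sat w phi X) phis) | X <- lex_tuples n.+1 k].

Definition lindstrom (A T : finType) (K : language T) (bs : seq T) (b : T)
    (k : nat) (phis : seq (formula A k)) n (w : n.+1.-tuple A) : Prop :=
  K (lindstrom_word bs b phis w).

(** * Groupoids *)

Record groupoid := Groupoid {
  carrier :> finType;
  gop : carrier -> carrier -> carrier
}.

(* [evaluates w g]: some bracketing of the (nonempty) word w has value g. *)
Inductive evaluates (G : groupoid) : seq G -> G -> Prop :=
| evaluates_letter g : evaluates [:: g] g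
| evaluates_gop u v g h :
    evaluates u g -> evaluates v h -> evaluates (u ++ v) (gop g h).

Definition word_problem (G : groupoid) (S : {set G}) : language G :=
  fun w => exists2 g, g \in S & evaluates w g.

(* Formulas speak of nonempty words only, so definability constrains L on
   nonempty words. *)
Definition in_QFO (G : groupoid) (A : finType) (L : language A) : Prop :=
  exists (S : {set G}) (bs : seq G) (b : G) (k : nat) (phis : seq (formula A k)),
    [/\ enum G = rcons bs b, 0 < k, size phis = size bs
      & forall n (w : n.+1.-tuple A),
          L w <-> lindstrom (word_problem S) bs b phis w].

(** * Context-free languages *)

Record cfg (B : finType) := Cfg {
  nonterminal : finType;
  start_symbol : nonterminal;
  rules : seq (nonterminal * seq (nonterminal + B))
}.

Inductive derives1 (B : finType) (g : cfg B) :
    seq (nonterminal g + B) -> seq (nonterminal g + B) -> Prop :=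
| Derives1 u v N r :
    (N, r) \in rules g -> derives1 (u ++ inl N :: v) (u ++ r ++ v).

Definition generated (B : finType) (g : cfg B) : language B :=
  fun w => clos_refl_trans _ (@derives1 B g) [:: inl (start_symbol g)] [seq inr x | x <- w].

Definition context_free (B : finType) (K : language B) : Prop :=
  exists g : cfg B, forall w, K w <-> generated g w.

(** * Logspace transducers *)

Inductive input_symbol (A : Type) := LeftEnd | RightEnd | Input of A.
Arguments LeftEnd {A}.
Arguments RightEnd {A}.

Inductive move := MoveLeft | Stay | MoveRight.

(* Deterministic machine with a read-only two-way input tape (delimited by end
   markers), a one-way infinite work tape and a write-only output tape.  A
   transition yields the new state, the symbol written on the work tape, the
   moves of the input head and of the work head, and the symbol output, if any;
   the machine halts when there is no transition. *)
Record transducer (A B : finType) := Transducer {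
  state : finType;
  work_symbol : finType;
  init_state : state;
  blank : work_symbol;
  delta : state -> input_symbol A -> work_symbol ->
    option (state * work_symbol * move * move * option B)
}.

Record config (A B : finType) (M : transducer A B) := Config {
  cstate : state M;
  input_pos : nat;
  work_pos : nat;
  work_tape : nat -> work_symbol M;
  output : seq B
}.

(* The letters of w are in cells 1, ..., size w, between the end markers. *)
Definition read_input (A : finType) (w : seq A) (i : nat) : input_symbol A :=
  if i is i'.+1 then
    if onth w i' is Some a then Input a else RightEnd
  else LeftEnd.

Definition shift (d : move) (i : nat) : nat :=
  match d with MoveLeft => i.-1 | Stay => i | MoveRight => i.+1 end.

Section Run.
Variables (A B : finType) (M : transducer A B) (w : seq A).

Definition transition (c : config M) :=
  delta (cstate c) (read_input w (input_pos c)) (work_tape c (work_pos c)).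

Definition step (c : config M) : config M :=
  if transition c is Some (q, s, di, dw, o) then
    {| cstate := q;
       input_pos := minn (shift di (input_pos c)) (size w).+1;
       work_pos := shift dw (work_pos c);
       work_tape := fun i => if i == work_pos c then s else work_tape c i;
       output := if o is Some x then rcons (output c) x else output c |}
  else c.

Definition init_config : config M :=
  {| cstate := init_state M; input_pos := 0; work_pos := 0;
     work_tape := fun=> blank M; output := [::] |}.

Definition run (t : nat) : config M := iter t step init_config.

End Run.

Definition computes (A B : finType) (M : transducer A B) (f : seq A -> seq B) :=
  forall w, exists t, transition w (run M w t) = None /\ output (run M w t) = f w.

Definition log_space_bounded (A B : finType) (M : transducer A B) :=
  exists c, forall w t, work_pos (run M w t) <= c * (trunc_log 2 (size w)).+1.

Definition logspace_computable (A B : finType) (f : seq A -> seq B) : Prop :=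
  exists M : transducer A B, computes M f /\ log_space_bounded M.

Definition LOGCFL (A : finType) (L : language A) : Prop :=
  exists (B : finType) (K : language B) (f : seq A -> seq B),
    [/\ context_free K, logspace_computable f & forall w, L w <-> K (f w)].

(* Main.v *)
(* A word over the fixed groupoid is made to describe a pushdown computation. The letters push
   or pop one of two stack symbols, and the brackets SegL, SegR delimit optional segments, which are
   executed or skipped; a word is accepted when some choice leads from the empty stack to the empty
   stack. This is a context-free condition, hence the word problem of a groupoid of sets of
   nonterminals.

   Such a word evaluates any path system given by first-order rules X <- Y, Z on k-tuples of
   positions: X is coded on the stack in unary by its lexicographic rank, each rule is a segment
   that pops X and pushes Z and Y, and the list of all the rules is repeated n^d times, which is
   enough when derivations have size at most n^d. No arithmetic on positions is needed.

   A language in LOGCFL is such a path system. The node (q, c, c') states that the output of the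
   transducer between the configurations c and c' is derived from the symbol q of a binary grammar;
   the contents of the work tape on either side of the head are numbers smaller than n^k, and the
   only arithmetic involved, Y = b X + r, is itself evaluated by the path system, by counting. *)

Require Import Defs.
From Stdlib Require Import Relation_Operators.
From HB Require Import structures.
From mathcomp Require Import all_boot.
From mathcomp Require Import boolp zify.

Set Implicit Arguments.
Unset Strict Implicit.
Unset Printing Implicit Defensive.

(** * Optional segments and the groupoid *)

(** A grammar in binary normal form becomes a groupoid when sets of nonterminals are multiplied: a
    nonterminal derives a word exactly when some bracketing of the word evaluates to a set
    containing it. The groupoid may not depend on the language, so its grammar knows only two stack
    symbols, and all that is specific to a language enters through the formulas that produce the
    word. These formulas must give a letter to every tuple, whatever the word encodes; hence a
    neutral letter for the tuples that encode nothing. Unary blocks arise by comparing a counter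
    with a rank, which needs only the lexicographic order. The segments occur in a fixed order while
    a derivation uses its rules in any order, so each copy of the list is relied upon for a single
    step. The polynomial bound on derivations comes from the halting time of a machine in
    logarithmic space. Nodes of the path system may mention configurations that never occur; their
    meaning is therefore stated relative to the actual run, where it holds vacuously for them. *)

Section PowersetGroupoid.

Variables (Q : finType) (rule : Q -> Q -> Q -> bool).

(** The product retains every nonterminal that the two factors allow, so a deterministic operation
    accounts for ambiguous rules and letters. *)
Definition powerset_op (U V : {set Q}) : {set Q} :=
  [set z | [exists x in U, exists y in V, rule x y z]].

Definition powerset_groupoid := Groupoid powerset_op.

Variables (L : Type) (lab : L -> {set Q}).

Inductive gen : seq L -> Q -> Prop :=
| gen_letter l q : q \in lab l -> gen [:: l] q
| gen_rule u v x y z : gen u x -> gen v y -> rule x y z -> gen (u ++ v) z.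

Lemma map_eq_cat (S T : Type) (f : S -> T) u v1 v2 :
  map f u = v1 ++ v2 -> exists u1 u2, [/\ u = u1 ++ u2, map f u1 = v1 & map f u2 = v2].
Proof.
move=> e; exists (take (size v1) u), (drop (size v1) u).
by rewrite cat_take_drop map_take map_drop e take_size_cat ?drop_size_cat.
Qed.

Lemma evaluates_gen u q :
  (exists2 U : powerset_groupoid, q \in (U : {set Q}) & @evaluates powerset_groupoid (map lab u) U)
  <-> gen u q.
Proof.
split=> [[U Uq ev]|].
  have [w e] : exists w, w = map lab u by eexists.
  rewrite -e in ev; elim: ev u q e Uq => {w U} [U|w1 w2 U V _ IH1 _ IH2] u q.
    case: u => [|l [|? ?]] //= [->] Uq; exact: gen_letter.
  move=> /esym/map_eq_cat[u1 [u2 [-> e1 e2]]].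
  rewrite inE => /exists_inP[x Ux /exists_inP[y Vy r]].
  by apply: gen_rule r; [exact: IH1|exact: IH2].
elim=> {u q} [l q lq|u v x y z _ [U Ux evU] _ [V Vy evV] r].
  by exists (lab l) => //; exact: (@evaluates_letter powerset_groupoid).
exists (powerset_op U V).
  by rewrite inE; apply/exists_inP; exists x => //; apply/exists_inP; exists y.
by rewrite map_cat; exact: (@evaluates_gop powerset_groupoid).
Qed.

End PowersetGroupoid.

Inductive letter := Push of bool | Pop of bool | SegL | SegR.

Definition plain (l : letter) :=
  match l with SegL | SegR => false | _ => true end.

(** The brackets of an executed segment are ignored one by one, without matching them. Only a skip
    uses a pair of brackets, and plainness of [u] keeps it from running past the first [SegR]. *)
Inductive Run : seq letter -> seq bool -> seq bool -> Prop :=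
| run_nil s : Run [::] s s
| run_push b w s s' : Run w (b :: s) s' -> Run (Push b :: w) s s'
| run_pop b w s s' : Run w s s' -> Run (Pop b :: w) (b :: s) s'
| run_segL w s s' : Run w s s' -> Run (SegL :: w) s s'
| run_segR w s s' : Run w s s' -> Run (SegR :: w) s s'
| run_skip u w s s' :
    all plain u -> Run w s s' -> Run (SegL :: u ++ SegR :: w) s s'.

Lemma Run_cat u v s1 s2 s3 : Run u s1 s2 -> Run v s2 s3 -> Run (u ++ v) s1 s3.
Proof.
elim=> {u s1 s2} //= [b w s s' _ IH|b w s s' _ IH|w s s' _ IH|w s s' _ IH|u w s s' pu _ IH] rv.
- exact: run_push (IH rv).
- exact: run_pop (IH rv).
- exact: run_segL (IH rv).
- exact: run_segR (IH rv).
- by rewrite -catA; exact: run_skip (IH rv).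
Qed.

Lemma Run_nilE s s' : Run [::] s s' -> s = s'.
Proof. by move=> r; inversion r. Qed.

Lemma Run_pushE b w s s' : Run (Push b :: w) s s' -> Run w (b :: s) s'.
Proof. by move=> r; inversion r. Qed.

Lemma Run_popE b w s s' : Run (Pop b :: w) s s' ->
  exists2 s1, s = b :: s1 & Run w s1 s'.
Proof. by move=> r; inversion r; subst; eexists. Qed.

Lemma Run_segRE w s s' : Run (SegR :: w) s s' -> Run w s s'.
Proof. by move=> r; inversion r. Qed.

Lemma Run_segLE w s s' : Run (SegL :: w) s s' ->
  Run w s s' \/ exists u v, [/\ w = u ++ SegR :: v, all plain u & Run v s s'].
Proof. by move=> r; inversion r; subst; [left|right; do 2 eexists]. Qed.

(* [Bal] derives the words that leave the stack unchanged, [Skip] an initial part of a skipped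
   segment, and [Any] every letter that may occur inside a skipped segment. *)
Inductive nt := Bal | Open of bool | Close of bool | Skip | End | Any.

Definition nt_code (x : nt) : option (option (option (option (bool + bool)))) :=
  match x with
  | Bal => None | Skip => Some None | End => Some (Some None)
  | Any => Some (Some (Some None))
  | Open b => Some (Some (Some (Some (inl b))))
  | Close b => Some (Some (Some (Some (inr b))))
  end.

Definition nt_decode x : nt :=
  match x with
  | None => Bal | Some None => Skip | Some (Some None) => End
  | Some (Some (Some None)) => Any
  | Some (Some (Some (Some (inl b)))) => Open b
  | Some (Some (Some (Some (inr b)))) => Close b
  end.

Lemma nt_codeK : cancel nt_code nt_decode.
Proof. by case. Qed.

HB.instance Definition _ := Finite.copy nt (can_type nt_codeK).

(** [Open b] absorbs balanced words on its right only; a balanced word to the left of a push belongs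
    to the factor of the stack symbol below. *)
Definition nt_rule (x y z : nt) : bool :=
  match x, y, z with
  | Bal, Bal, Bal => true
  | Open b, Bal, Open b' => b == b'
  | Open b, Close b', Bal => b == b'
  | Skip, Any, Skip => true
  | Skip, End, Bal => true
  | _, _, _ => false
  end.

(* [None] is a neutral letter. A segment bracket is neutral too, so that executing a segment amounts
   to ignoring its brackets. *)
Definition letter_set (o : option letter) : {set nt} :=
  match o with
  | None => [set Bal; Any]
  | Some (Push b) => [set Open b; Any]
  | Some (Pop b) => [set Close b; Any]
  | Some SegL => [set Bal; Skip]
  | Some SegR => [set Bal; End]
  end.

Notation der := (gen nt_rule letter_set).

Definition strip (u : seq (option letter)) : seq letter := pmap id u.

Lemma strip_cat u v : strip (u ++ v) = strip u ++ strip v.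
Proof. exact: pmap_cat. Qed.

Definition der_spec (u : seq (option letter)) (z : nt) : Prop :=
  match z with
  | Bal => forall s, Run (strip u) s s
  | Open b => forall s, Run (strip u) s (b :: s)
  | Close b => forall s, Run (strip u) (b :: s) s
  | Skip => exists2 v, strip u = SegL :: v & all plain v
  | End => strip u = [:: SegR]
  | Any => all plain (strip u)
  end.

Lemma der_sound u z : der u z -> der_spec u z.
Proof.
elim=> {u z} [l z|u v x y z _ IHu _ IHv].
  case: l => [[b|b||]|] /=; rewrite !inE => /orP[]/eqP-> //=; try by
     [move=> s; do ?[apply: run_push|apply: run_pop|apply: run_segL|apply: run_segR]; constructor].
  by exists [::].
rewrite /der_spec strip_cat.
case: x y z IHu IHv => [|b|b|||] [|b'|b'|||] [|b''|b''|||] //=.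
- by move=> hu hv _ s; apply: Run_cat (hu s) (hv s).
- by move=> hu hv /eqP<- s; apply: Run_cat (hu s) (hv _).
- by move=> hu hv /eqP e s; apply: Run_cat (hu s) _; rewrite e; exact: hv.
- by move=> [w e pw] -> _ s; rewrite e /= -[[:: SegR]]/(SegR :: [::]); apply: run_skip => //; constructor.
- by move=> [w e pw] pv _; exists (w ++ strip v); rewrite ?e // all_cat pw.
Qed.

(* Invariant of the parse from left to right: one factor for each stack symbol, each of them
   absorbing the balanced factors that follow it. *)
Inductive stacked : seq (option letter) -> seq bool -> Prop :=
| stacked_nil : stacked [::] [::]
| stacked_bal u : der u Bal -> stacked u [::]
| stacked_push u v s b : stacked u s -> der v (Open b) -> stacked (u ++ v) (b :: s).

Lemma stacked_consE w b s : stacked w (b :: s) ->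
  exists u v, [/\ w = u ++ v, stacked u s & der v (Open b)].
Proof. by move=> st; inversion st; subst; exists u, v. Qed.

Lemma stacked_absorb u v s : stacked u s -> der v Bal -> stacked (u ++ v) s.
Proof.
case=> {u s} [|u du|u u' s b st du'] dv.
- exact: stacked_bal.
- by apply: stacked_bal; exact: gen_rule du dv _.
- rewrite -catA; apply: stacked_push st _; apply: gen_rule du' dv _; exact: eqxx.
Qed.

Lemma strip_eq_cat u v l w : strip u = v ++ l :: w ->
  exists u1 u2, [/\ u = u1 ++ Some l :: u2, strip u1 = v & strip u2 = w].
Proof.
elim: u v => [|[l'|] u IH] v /=; first by case: v.
  case: v => [|l'' v] /= [<- e].
    by exists [::], u.
  by have [u1 [u2 [-> <- <-]]] := IH _ e; exists (Some l' :: u1), u2.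
by move=> /IH[u1 [u2 [-> <- <-]]]; exists (None :: u1), u2.
Qed.

Lemma der_skip u : all plain (strip u) -> der (Some SegL :: u ++ [:: Some SegR]) Bal.
Proof.
move=> pu; rewrite -cat_cons.
suff h : der (Some SegL :: u) Skip.
  apply: (gen_rule h (y := End)) => //; apply: gen_letter; by rewrite !inE eqxx orbT.
elim/last_ind: u pu => [_|u l IH]; first by apply: gen_letter; rewrite !inE eqxx orbT.
rewrite -cats1 strip_cat all_cat => /andP[/IH h pl].
rewrite -cat_cons; apply: (gen_rule h (y := Any)) => //.
by apply: gen_letter; case: l pl => [[b|b||]|] //= _; rewrite !inE eqxx orbT.
Qed.

(** The parse follows the run: a push adds a factor, a pop closes the topmost factor into a balanced
    word, and that word, like every skipped segment or neutral letter, is absorbed by what lies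
    below. *)
Lemma Run_stacked u u0 s s' :
  Run (strip u) s s' -> stacked u0 s -> stacked (u0 ++ u) s'.
Proof.
(* Strong induction on the length, because a skipped segment is consumed at once. *)
have [m] := ubnP (size u); elim: m u u0 s => // m IH [|l u] u0 s /=.
  by rewrite cats0 => _ /Run_nilE->.
rewrite ltnS => lt_um.
have absorb : der [:: l] Bal -> Run (strip u) s s' -> stacked u0 s ->
    stacked (u0 ++ l :: u) s'.
  move=> dl r st; rewrite -cat1s catA; apply: IH r _ => //.
  exact: stacked_absorb.
case: l absorb => [l|] absorb /=; last first.
  by apply: absorb; apply: gen_letter; rewrite !inE.
case: l absorb => [b|b||] absorb r st.
- rewrite -cat1s catA; apply: IH (Run_pushE r) _ => //.
  by apply: stacked_push st _; apply: gen_letter; rewrite !inE eqxx.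
- have [s1 es {}r] := Run_popE r; rewrite es in st.
  have [u1 [v [-> {}st dv]]] := stacked_consE st.
  rewrite -(cat1s (Some _) u) -catA (catA v) catA.
  apply: IH r _ => //; apply: stacked_absorb => //.
  apply: (gen_rule dv (y := Close b)); last exact: eqxx.
  by apply: gen_letter; rewrite !inE eqxx.
- case/Run_segLE: r => [r|[v [w [e pv r]]]].
    by apply: absorb => //; apply: gen_letter; rewrite !inE.
  have [u1 [u2 [? e1 e2]]] := strip_eq_cat e; subst.
  have -> : u0 ++ Some SegL :: u1 ++ Some SegR :: u2 =
     (u0 ++ (Some SegL :: u1 ++ [:: Some SegR])) ++ u2.
    by rewrite -!catA /= -catA.
  apply: IH r _.
    by apply: leq_trans lt_um; rewrite size_cat /= addnS ltnS leqW // leq_addl.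
  by apply: stacked_absorb => //; exact: der_skip.
- by apply: absorb (Run_segRE r) _ => //; apply: gen_letter; rewrite !inE.
Qed.

(** The empty word has an accepting run but no derivation, whence the hypothesis. A nonempty word of
    neutral letters is derivable. *)
Lemma der_Run u : 0 < size u -> der u Bal <-> Run (strip u) [::] [::].
Proof.
move=> u0; split=> [/der_sound|r]; first exact.
have := Run_stacked r stacked_nil; rewrite /= => st.
by inversion st; subst.
Qed.

Definition the_groupoid := powerset_groupoid nt_rule.

Lemma word_problem_Run u : 0 < size u ->
  @word_problem the_groupoid [set U : the_groupoid | Bal \in (U : {set nt})] (map letter_set u)
  <-> Run (strip u) [::] [::].
Proof.
move=> u0; split=> [[U] |/(der_Run u0)/(evaluates_gen nt_rule letter_set u Bal)].
  rewrite inE => bU ev; apply/(der_Run u0).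
  by apply/(evaluates_gen nt_rule letter_set u Bal); exists U.
by case=> U bU ev; exists U; rewrite ?inE.
Qed.

(** * Rewriting a stack of numbers *)

Definition pop_word (r : nat) := rcons (nseq r (Pop true)) (Pop false).
Definition push_word (r : nat) := Push false :: nseq r (Push true).
(** The list is pushed in reverse so that its first number ends up on top; likewise [push_word]
    writes a code from its bottom symbol [false] upwards. *)
Definition body (e : nat * seq nat) :=
  pop_word e.1 ++ flatten (map push_word (rev e.2)).
Definition segment (e : nat * seq nat) := SegL :: body e ++ [:: SegR].
Arguments segment : simpl never.
(* The top of the stack comes first: the number r is coded by r times [true], then [false]. The code
   is prefix-free, so that [pop_word r] succeeds exactly when the top number is r. *)
Definition codes (gl : seq nat) := flatten [seq rcons (nseq r true) false | r <- gl].

Lemma Run_pop_wordE r w s s' : Run (pop_word r ++ w) s s' ->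
  exists2 s1, s = nseq r true ++ false :: s1 & Run w s1 s'.
Proof.
rewrite /pop_word cat_rcons; elim: r s => [|r IH] s /= /Run_popE[s1 -> //].
  by exists s1.
by move=> /IH[s2 -> h]; exists s2.
Qed.

Lemma Run_pop_word r w s s' :
  Run w s s' -> Run (pop_word r ++ w) (nseq r true ++ false :: s) s'.
Proof.
by rewrite /pop_word cat_rcons => h; elim: r => [|r IH] /=; apply: run_pop.
Qed.

Lemma codes_cons r gl : codes (r :: gl) = nseq r true ++ false :: codes gl.
Proof. by rewrite /codes /= cat_rcons. Qed.

Lemma codes_eqE gl r s : codes gl = nseq r true ++ false :: s ->
  exists2 gl', gl = r :: gl' & s = codes gl'.
Proof.
case: gl => [|r' gl]; first by case: r.
rewrite codes_cons => e; suff [-> <-] : r' = r /\ codes gl = s by exists gl.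
by elim: r' r e => [|r' IH] [|r] //= [] // /IH[->].
Qed.

Lemma Run_push_word r w s s' :
  Run (push_word r ++ w) s s' <-> Run w (nseq r true ++ false :: s) s'.
Proof.
rewrite /push_word /=.
have h t : Run (nseq r (Push true) ++ w) t s' <-> Run w (nseq r true ++ t) s'.
  elim: r t => //= r IH t; have e : nseq r true ++ true :: t = true :: nseq r true ++ t.
    by elim: r {IH} => //= r ->.
  by split=> [/Run_pushE/IH|]; rewrite ?e // -e => /IH; exact: run_push.
by split=> [/Run_pushE/h|/h]; rewrite // => /run_push.
Qed.

Lemma Run_push_words rs w gl s' :
  Run (flatten (map push_word (rev rs)) ++ w) (codes gl) s' <->
  Run w (codes (rs ++ gl)) s'.
Proof.
elim/last_ind: rs gl => [|rs r IH] gl //.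
rewrite rev_rcons /= -catA cat_rcons.
split=> [/Run_push_word|].
  by rewrite -codes_cons => /IH.
by move=> /IH h; apply/Run_push_word; rewrite -codes_cons.
Qed.

Lemma body_plain e : all plain (body e).
Proof.
rewrite all_cat all_rcons all_nseq /= orbT /=.
by elim: (rev _) => //= r rs IH; rewrite all_cat IH all_nseq orbT.
Qed.

(** Both prefixes stop at the first [SegR]. Hence a skip begun at a segment removes exactly that
    segment. *)
Lemma plain_prefix u u' v v' : all plain u -> all plain u' ->
  u ++ SegR :: v = u' ++ SegR :: v' -> v = v'.
Proof.
elim: u u' => [|l u IH] [|l' u'] //=; first by move=> _ _ [].
- by move=> _ /andP[pl' _] [e]; rewrite -e in pl'.
- by move=> /andP[pl _] _ [e]; rewrite e in pl.
- by move=> /andP[_ pu] /andP[_ pu'] [_]; exact: IH.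
Qed.

Lemma Run_segmentE e w gl s' : Run (segment e ++ w) (codes gl) s' ->
  Run w (codes gl) s' \/
  exists2 gl', gl = e.1 :: gl' & Run w (codes (e.2 ++ gl')) s'.
Proof.
rewrite /segment cat_cons -catA => /Run_segLE[].
  rewrite /body -catA => /Run_pop_wordE[s1 /codes_eqE[gl' -> ->]].
  by move=> /Run_push_words/Run_segRE; right; exists gl'.
case=> u [v [/esym h pu r]]; left.
by rewrite -(plain_prefix pu (body_plain e) h).
Qed.

Lemma Run_segment_skip e w s s' : Run w s s' -> Run (segment e ++ w) s s'.
Proof.
by move=> h; rewrite /segment cat_cons -catA; apply: run_skip h; exact: body_plain.
Qed.

Lemma Run_segment_keep a rs w gl s' :
  Run w (codes (rs ++ gl)) s' -> Run (segment (a, rs) ++ w) (codes (a :: gl)) s'.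
Proof.
move=> h; rewrite /segment cat_cons -catA /body -catA /=; apply: run_segL.
by rewrite codes_cons; apply/Run_pop_word/Run_push_words/run_segR.
Qed.

(** * Resolution of a stack of goals *)

Section Solve.

Variable E : seq (nat * seq nat).

(** Depth-first resolution that always treats the first goal, as a stack does; the last argument
    counts the rules applied. *)
Inductive solve : seq nat -> nat -> Prop :=
| solve_nil : solve [::] 0
| solve_cons a rs gl m :
    (a, rs) \in E -> solve (rs ++ gl) m -> solve (a :: gl) m.+1.

Lemma Run_solve es gl : {subset es <= E} ->
  Run (flatten (map segment es)) (codes gl) [::] -> exists m, solve gl m.
Proof.
elim: es gl => [|e es IH] gl sE.
  case: gl => [|r gl]; first by exists 0; constructor.
  by move=> /Run_nilE; rewrite codes_cons; case: r.
have {}IH := IH _ (fun x h => sE x (mem_behead (s := e :: es) h)).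
move=> /Run_segmentE[/IH //|[gl' -> /IH[m h]]].
by exists m.+1; apply: solve_cons h; rewrite -surjective_pairing sE ?mem_head.
Qed.

(** Each copy of the list serves one step: all its segments are skipped except the one in use. The
    surplus copies are skipped entirely. *)
Lemma solve_Run gl m T : solve gl m -> m <= T ->
  Run (flatten (nseq T (flatten (map segment E)))) (codes gl) [::].
Proof.
have skip es w s : Run w s [::] -> Run (flatten (map segment es) ++ w) s [::].
  elim: es => //= e es IH h; rewrite -catA.
  by apply: Run_segment_skip; exact: IH.
move=> h; elim: h T => {gl m} [|a rs gl m aE _ IH] [|T] //=.
- by constructor.
- move=> _; elim: T => [|T IH] /=; apply: skip => //; constructor.
- move=> /IH h; have [E1 [E2 e]] : exists E1 E2, E = E1 ++ (a, rs) :: E2.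
    exists (take (index (a, rs) E) E), (drop (index (a, rs) E).+1 E).
    by rewrite -{2}(nth_index (0, [::]) aE) -drop_nth ?index_mem // cat_take_drop.
  rewrite {1}e map_cat flatten_cat -catA; apply: (skip) => /=.
  by rewrite -catA; apply: Run_segment_keep; exact: skip.
Qed.

Lemma Run_word T :
  Run (Push false :: flatten (nseq T (flatten (map segment E)))) [::] [::] ->
  exists m, solve [:: 0] m.
Proof.
move=> /Run_pushE.
have -> : flatten (nseq T (flatten (map segment E))) =
    flatten (map segment (flatten (nseq T E))).
  by elim: T => //= T ->; rewrite map_cat flatten_cat.
apply: (@Run_solve _ [:: 0]) => e /flattenP[E' /nseqP[-> _]]; exact.
Qed.

Lemma Run_word_of_solve m T : solve [:: 0] m -> m <= T ->
  Run (Push false :: flatten (nseq T (flatten (map segment E)))) [::] [::].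
Proof. by move=> h mT; apply: run_push; exact: (solve_Run h mT). Qed.

End Solve.

(** * Words indexed by tuples *)

Definition lexs n k : seq (seq 'I_n) := [seq val X | X <- lex_tuples n k].

Fixpoint lexval n (v : seq 'I_n) : nat :=
  if v is x :: v' then x * n ^ size v' + lexval v' else 0.

Lemma lexsS n k : lexs n k.+1 = [seq x :: v | x <- enum 'I_n, v <- lexs n k].
Proof. by rewrite /lexs /= map_allpairs; congr flatten; apply: eq_map => x; rewrite -map_comp. Qed.

Lemma size_lexs n k v : v \in lexs n k -> size v = k.
Proof. by case/mapP=> X _ ->; rewrite size_tuple. Qed.

Lemma mem_lexs n k v : (v \in lexs n k) = (size v == k).
Proof.
apply/idP/idP=> [/size_lexs->//|]; elim: k v => [|k IH] [|x v] //= sv.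
by rewrite lexsS; apply/allpairsP; exists (x, v); rewrite mem_enum IH.
Qed.

Lemma lexval_lt n (v : seq 'I_n) : lexval v < n ^ size v.
Proof.
elim: v => //= x v IH; rewrite expnS.
apply: leq_trans (_ : x.+1 * n ^ size v <= _); first by rewrite mulSn addnC ltn_add2r.
by rewrite leq_mul2r ltn_ord orbT.
Qed.

(** The value in base n is the lexicographic rank. Injectivity, surjectivity and the number of
    tuples are all read off this enumeration. *)
Lemma map_lexval n k : map (@lexval n) (lexs n k) = iota 0 (n ^ k).
Proof.
elim: k => [|k IH] //; rewrite lexsS map_allpairs.
have -> : [seq lexval (x :: v) | x <- enum 'I_n, v <- lexs n k] =
    flatten [seq iota (i * n ^ k) (n ^ k) | i <- iota 0 n].
  rewrite -val_enum_ord -map_comp; congr flatten; apply: eq_map => x /=.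
  rewrite -[x * _]addn0 iotaDl -IH -map_comp; apply/eq_in_map => v /size_lexs /= ->.
  by [].
rewrite expnS; move: (n ^ k) => N; clear IH; elim: n => [|n IH]; first by rewrite mul0n.
rewrite -[in LHS]addn1 iotaD map_cat flatten_cat IH /= cats0.
by rewrite mulSn [(N + _)%N]addnC iotaD add0n.
Qed.

Lemma lexval_inj n k : {in lexs n k &, injective (@lexval n)}.
Proof.
have h v : v \in lexs n k -> nth [::] (lexs n k) (lexval v) = v.
  move=> vl; rewrite -{2}(nth_index [::] vl); congr nth.
  have := @nth_map _ [::] _ 0 (@lexval n) (index v (lexs n k)) (lexs n k).
  rewrite index_mem map_lexval nth_index // => /(_ vl) <-.
  rewrite nth_iota // -(size_iota 0 (n ^ k)) -map_lexval size_map index_mem //.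
by move=> u v ul vl e; rewrite -(h u ul) e h.
Qed.

Lemma lexval_surj n k i : i < n ^ k -> exists2 v, size v = k & @lexval n v = i.
Proof.
move=> lt; have : i \in map (@lexval n) (lexs n k) by rewrite map_lexval mem_iota.
by case/mapP=> v /size_lexs sv ->; exists v.
Qed.

Lemma pmap_flatten (S T : Type) (f : S -> option T) ss :
  pmap f (flatten ss) = flatten (map (pmap f) ss).
Proof. by elim: ss => //= s ss <-; rewrite pmap_cat. Qed.

Lemma flatten_flatten T (sss : seq (seq (seq T))) :
  flatten (flatten sss) = flatten (map flatten sss).
Proof. by elim: sss => //= ss sss <-; rewrite flatten_cat. Qed.

Lemma pmap_map (S T U : Type) (f : T -> option U) (g : S -> T) s :
  pmap f (map g s) = pmap (f \o g) s.
Proof. by elim: s => //= x s ->. Qed.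

Lemma pmap_lexsS n k T (f : seq 'I_n -> option T) :
  pmap f (lexs n k.+1) =
  flatten [seq pmap (fun v => f (x :: v)) (lexs n k) | x <- enum 'I_n].
Proof.
rewrite lexsS pmap_flatten -map_comp; congr flatten; apply: eq_map => x /=.
by rewrite pmap_map.
Qed.

Lemma pmap_lexs_cat n a b T (f : seq 'I_n -> option T) :
  pmap f (lexs n (a + b)) =
  flatten [seq pmap (fun v => f (u ++ v)) (lexs n b) | u <- lexs n a].
Proof.
elim: a f => [|a IH] f; first by rewrite /= cats0; apply: eq_pmap.
rewrite addSn pmap_lexsS lexsS map_flatten flatten_flatten -!map_comp.
congr flatten; apply: eq_map => x /=; rewrite IH -map_comp.
by congr flatten; apply: eq_map.
Qed.

Lemma lexs_headE n k : exists s,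
  lexs n.+1 k = nseq k ord0 :: s /\ {in s, forall v, 0 < lexval v}.
Proof.
have := map_lexval n.+1 k; have : 0 < n.+1 ^ k by rewrite expn_gt0.
case: (n.+1 ^ k) => // N _; case E : (lexs n.+1 k) => [|v s] //= [v0 es].
have sv : size v = k by apply: (@size_lexs n.+1); rewrite E mem_head.
exists s; split; last first.
  by move=> u /(map_f (@lexval n.+1)); rewrite es mem_iota => /andP[].
congr cons; apply: (@lexval_inj n.+1 k); rewrite ?mem_lexs ?sv ?size_nseq //.
by rewrite v0; elim: k {E es v0 sv} => //= k <-.
Qed.

Lemma lexval_eq0 n (v : seq 'I_n.+1) : (lexval v == 0) = all (pred1 ord0) v.
Proof.
elim: v => //= x v <-; rewrite addn_eq0 muln_eq0 expn_eq0 /=.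
by rewrite orbF; congr andb.
Qed.

Lemma enum_ord_ends n : exists s, enum 'I_n.+2 = ord0 :: rcons s ord_max /\
  {in s, forall x, (x != ord0) && (x != ord_max)}.
Proof.
have e : enum 'I_n.+2 =
    ord0 :: rcons [seq lift ord0 (widen_ord (leqnSn n) i) | i <- enum 'I_n] ord_max.
  rewrite enum_ordSl enum_ordSr map_rcons -map_comp; congr (_ :: rcons _ _).
  exact: val_inj.
exists [seq lift ord0 (widen_ord (leqnSn n) i) | i <- enum 'I_n]; split=> //.
move=> x /mapP[i _ ->]; rewrite -!val_eqE /= /bump /= add1n eqSS.
by rewrite neq_ltn ltn_ord.
Qed.

(** A coordinate serves as a bit, with values minimum and maximum; these differ because the universe
    has at least two elements. *)
Lemma flatten_bit n T (f : 'I_n.+2 -> seq T) :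
  (forall x, x != ord0 -> x != ord_max -> f x = [::]) ->
  flatten [seq f x | x <- enum 'I_n.+2] = f ord0 ++ f ord_max.
Proof.
move=> f0; have [s [-> hs]] := enum_ord_ends n.
rewrite /= map_rcons flatten_rcons; congr cat.
rewrite (_ : flatten _ = [::]) //; elim: s hs => //= x s IH hs.
have /andP[x0 xm] := hs x (mem_head _ _).
by rewrite f0 // IH // => y ys; apply: hs; rewrite inE ys orbT.
Qed.

Definition first_case T (cs : seq (bool * T)) (d : T) : T :=
  foldr (fun c r => if c.1 then c.2 else r) d cs.

(** * The word that lists the rules of a path system *)

Section Word.

Variables (n d k : nat).
Local Notation V := (seq 'I_n.+2).
Variables (R : V -> V -> V -> bool) (triv : V -> bool).

Definition slice T o l (v : seq T) := take l (drop o v).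

(* The three coordinates of p select the part of the segment, by whether they are minimal or maximal;
   j counts the letters of that part. *)
Definition segment_cases (A B C : V) (p : V) (j : V) : seq (bool * option letter) :=
  let lo i := nth ord0 p i == ord0 in
  let hi i := nth ord0 p i == ord_max in
  [:: ([&& lo 0, lo 1, hi 2 & lexval j == 0], Some SegL);
      ([&& lo 0, hi 1, lo 2 & lexval j < lexval A], Some (Pop true));
      ([&& lo 0, hi 1, lo 2 & lexval j == lexval A], Some (Pop false));
      ([&& lo 0, hi 1, hi 2, ~~ triv C & lexval j == 0], Some (Push false));
      ([&& lo 0, hi 1, hi 2, ~~ triv C & lexval j <= lexval C], Some (Push true));
      ([&& hi 0, lo 1, lo 2, ~~ triv B & lexval j == 0], Some (Push false));
      ([&& hi 0, lo 1, lo 2, ~~ triv B & lexval j <= lexval B], Some (Push true));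
      ([&& hi 0, lo 1, hi 2 & lexval j == 0], Some SegR)].

Definition rule_cases (A B C p j : V) :=
  (~~ R A B C, None) :: segment_cases A B C p j.

(* A tuple v consists of d coordinates that only serve to repeat the word, of X, Y, Z, of the three
   coordinates selecting a part of the segment and of the counter. The first letter pushes the code
   of the number 0, which is the rank of the root. *)
Definition word_cases (v : V) :=
  (lexval v == 0, Some (Push false)) ::
  rule_cases (slice d k v) (slice (d + k) k v) (slice (d + k + k) k v)
    (slice (d + k + k + k) 3 v) (slice (d + k + k + k + 3) k v).

Definition word_letter (v : V) := first_case (word_cases v) None.

Definition word_width := d + (k + (k + (k + (3 + k)))).

(** Trivial premises are never pushed, so that rules with fewer than two premises fit the uniform
    shape. *)
Definition edge (A B C : V) := (lexval A, [seq lexval X | X <- [:: B; C] & ~~ triv X]).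

Definition edges :=
  flatten [seq flatten [seq flatten [seq
    if R A B C then [:: edge A B C] else [::]
  | C <- lexs n.+2 k] | B <- lexs n.+2 k] | A <- lexs n.+2 k].

Lemma pmap_lexval (h : nat -> option letter) :
  pmap (fun j => h (lexval j)) (lexs n.+2 k) = pmap h (iota 0 (n.+2 ^ k)).
Proof. by rewrite -map_lexval pmap_map. Qed.

Lemma pmap_iota_none (h : nat -> option letter) i N :
  (forall j, i <= j -> h j = None) -> pmap h (iota i N) = [::].
Proof.
elim: N i => //= N IH i hi; rewrite hi //= IH // => j /ltnW; exact: hi.
Qed.

Lemma pmap_iota_eq0 (h : nat -> option letter) N l : 0 < N ->
  h 0 = Some l -> (forall j, 0 < j -> h j = None) -> pmap h (iota 0 N) = [:: l].
Proof. by case: N => //= N _ -> hj; rewrite pmap_iota_none. Qed.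

Lemma pmap_iota_lt (h : nat -> option letter) i a N l : i + a <= N ->
  (forall j, i <= j < i + a -> h j = Some l) ->
  pmap h (iota i (N - i)) = nseq a l ++ pmap h (iota (i + a) (N - (i + a))).
Proof.
move=> aN ha.
have -> : N - i = a + (N - (i + a)).
  by rewrite subnDA subnKC // leq_subRL // (leq_trans _ aN) ?leq_addr.
rewrite iotaD pmap_cat; congr cat.
elim: a i {aN} ha => //= a IH i ha; rewrite ha ?leqnn ?addnS ?ltnS ?leq_addr //=.
by rewrite IH // => j /andP[ij ja]; apply: ha; rewrite ltnW //= addnS -addSn.
Qed.

Lemma pmap_pop_word a (h : nat -> option letter) N : a < N ->
  (forall j, h j = if j < a then Some (Pop true) else
     if j == a then Some (Pop false) else None) ->
  pmap h (iota 0 N) = pop_word a.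
Proof.
move=> aN hj; have := @pmap_iota_lt h 0 a N (Pop true); rewrite subn0 add0n => ->.
- rewrite /pop_word -cats1 -subnSK //= hj ltnn eqxx /=; congr cat; congr cons.
  by apply: pmap_iota_none => j aj; rewrite hj ltnNge ltnW //= gtn_eqF.
- exact: ltnW.
- by move=> j /= ja; rewrite hj ja.
Qed.

(** The counter value 0 writes [false] and each of 1, ..., a writes one [true], whence the weak
    inequality. In [pop_word] the [true] letters come first and use the values below a. *)
Lemma pmap_push_word a (h : nat -> option letter) N : a < N ->
  (forall j, h j = if j == 0 then Some (Push false) else
     if j <= a then Some (Push true) else None) ->
  pmap h (iota 0 N) = push_word a.
Proof.
move=> aN hj; rewrite /push_word; case: N aN => // N; rewrite ltnS => aN.
rewrite /= hj /=; congr cons.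
have := @pmap_iota_lt h 1 a N.+1 (Push true); rewrite subn1 add1n ltnS => -> //=.
  rewrite pmap_iota_none ?cats0 // => -[|j] // aj; rewrite hj /= leqNgt.
  by rewrite aj.
by move=> [|j] //= ja; rewrite hj /= -ltnS ja.
Qed.

Lemma pmap_none (S T : Type) (f : S -> option T) s :
  (forall x, f x = None) -> pmap f s = [::].
Proof. by move=> f0; elim: s => //= x s; rewrite f0. Qed.

Lemma flatten_nseq0 T N : flatten (nseq N [::]) = [::] :> seq T.
Proof. by elim: N. Qed.

Lemma map_const (S T : Type) (c : T) (s : seq S) : map (fun=> c) s = nseq (size s) c.
Proof. by elim: s => //= _ s ->. Qed.

Fixpoint bits l : seq V :=
  if l is l'.+1 then map (cons ord0) (bits l') ++ map (cons ord_max) (bits l')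
  else [:: [::]].

Lemma flatten_bits T l (F : V -> seq T) :
  (forall u, size u = l -> ~~ all (pred2 ord0 ord_max) u -> F u = [::]) ->
  flatten [seq F u | u <- lexs n.+2 l] = flatten [seq F u | u <- bits l].
Proof.
elim: l F => // l IH F F0; rewrite lexsS.
pose G x := flatten [seq F (x :: u) | u <- lexs n.+2 l].
have -> : flatten [seq F u | u <- [seq x :: v | x <- enum 'I_n.+2, v <- lexs n.+2 l]] =
    flatten [seq G x | x <- enum 'I_n.+2].
  elim: (enum _) => //= x s {}IH.
  by rewrite map_cat flatten_cat IH -map_comp.
rewrite flatten_bit => [|x x0 xm]; last first.
  rewrite /G (_ : [seq _ | _ <- _] = nseq (size (lexs n.+2 l)) [::]) ?flatten_nseq0 //.
  rewrite -map_const; apply/eq_in_map => u /size_lexs su.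
  by rewrite F0 //= ?su // (negPf x0) (negPf xm).
have {}IH x : pred2 ord0 ord_max x -> G x = flatten [seq F (x :: u) | u <- bits l].
  by move=> bx; apply: IH => u su nu; apply: F0; rewrite /= ?su // negb_and nu orbT.
by rewrite !IH /= ?eqxx ?orbT // map_cat flatten_cat -!map_comp.
Qed.

Lemma first_case_segment (A B C p j : V) : R A B C ->
  first_case (rule_cases A B C p j) None =
  first_case (segment_cases A B C p j) None.
Proof. by move=> r; rewrite /rule_cases /= r. Qed.

(** Read as bits in increasing order, the patterns 001, 010, 011, 100, 101 give the opening bracket,
    the pop of A, the push of C, the push of B and the closing bracket; the other three give only
    neutral letters. *)
Lemma pmap_rule_cases (A B C : V) :
  size A = k -> size B = k -> size C = k ->
  pmap (fun v => first_case (rule_cases A B C (slice 0 3 v) (slice 3 k v)) None)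
    (lexs n.+2 (3 + k)) =
  flatten (map segment (if R A B C then [:: edge A B C] else [::])).
Proof.
move=> sA sB sC.
have lt X : size X = k -> @lexval n.+2 X < n.+2 ^ k by move=> <-; exact: lexval_lt.
case RABC : (R A B C); last first.
  by apply: pmap_none => v; rewrite /rule_cases /= RABC.
rewrite pmap_lexs_cat.
pose F (p : V) := pmap (fun j => first_case (segment_cases A B C p j) None) (lexs n.+2 k).
rewrite (_ : flatten _ = flatten [seq F u | u <- lexs n.+2 3]); last first.
  congr flatten; apply/eq_in_map => u /size_lexs su; apply/eq_in_pmap.
  move=> v /size_lexs sv; rewrite first_case_segment //.
  by rewrite /slice drop0 -su take_size_cat // drop_size_cat // -sv take_size.
have N0 : 0 < n.+2 ^ k by rewrite expn_gt0.
rewrite flatten_bits; last first.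
  move=> [|x [|y [|z []]]] //= _ h; apply: pmap_none => j; rewrite /segment_cases /=.
  move: h; case: (x == ord0) (x == ord_max) (y == ord0) (y == ord_max)
    (z == ord0) (z == ord_max) => [] [] [] [] [] [] //=.
rewrite /= !cats0 /F /segment_cases /= !eqxx /=.
have one (l : letter) :
    pmap (fun j : V => if lexval j == 0 then Some l else None) (lexs n.+2 k) = [:: l].
  rewrite (pmap_lexval (fun j => if j == 0 then Some l else None)).
  by apply: pmap_iota_eq0 => // -[].
have push X : size X = k ->
    pmap (fun j : V => if ~~ triv X && (lexval j == 0) then Some (Push false)
      else if ~~ triv X && (lexval j <= lexval X) then Some (Push true) else None)
      (lexs n.+2 k) = if triv X then [::] else push_word (lexval X).
  case: (triv X) => [|/lt ltX] /=; first by rewrite pmap_none.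
  rewrite (pmap_lexval (fun j => if j == 0 then Some (Push false) else
    if j <= lexval X then Some (Push true) else None)).
  exact: pmap_push_word.
have none : pmap (fun=> @None letter) (lexs n.+2 k) = [::] by rewrite pmap_none.
rewrite !one !push // !none /=.
rewrite (pmap_lexval (fun j => if j < lexval A then Some (Pop true) else
    if j == lexval A then Some (Pop false) else None)).
rewrite (pmap_pop_word (lt A sA)) // /body /edge /=.
by case: (triv B); case: (triv C); rewrite /= ?cats0 -?catA /= ?cats0 -?catA.
Qed.

Lemma slice_catD T s o l (u v : seq T) :
  size u = s -> slice (s + o) l (u ++ v) = slice o l v.
Proof. by move=> <-; rewrite /slice drop_cat ltnNge leq_addr addKn. Qed.

Lemma slice_cat T s l (u v : seq T) : size u = s -> slice s l (u ++ v) = slice 0 l v.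
Proof. by rewrite -{2}[s]addn0; apply: slice_catD. Qed.

Lemma slice0_cat T l (u v : seq T) : size u = l -> slice 0 l (u ++ v) = u.
Proof. by move=> <-; rewrite /slice drop0 take_size_cat. Qed.

Lemma flatten_segments (T : Type) (F : T -> seq (nat * seq nat)) s :
  flatten (map segment (flatten [seq F x | x <- s])) =
  flatten [seq flatten (map segment (F x)) | x <- s].
Proof. by elim: s => //= x s <-; rewrite map_cat flatten_cat. Qed.

Lemma pmap_word_letter :
  pmap word_letter (lexs n.+2 word_width) =
  Push false :: flatten (nseq (n.+2 ^ d) (flatten (map segment edges))).
Proof.
pose g v := first_case (rule_cases (slice d k v) (slice (d + k) k v)
  (slice (d + k + k) k v)
    (slice (d + k + k + k) 3 v) (slice (d + k + k + k + 3) k v)) None.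
transitivity (Push false :: pmap g (lexs n.+2 word_width)).
  have [s [-> s0]] := @lexs_headE n.+1 word_width; rewrite /=.
  have z : lexval (nseq word_width (ord0 : 'I_n.+2)) = 0.
    by apply/eqP; rewrite lexval_eq0 all_nseq /= orbT.
  have -> : word_letter (nseq word_width ord0) = Some (Push false).
    by rewrite /word_letter /= z.
  (* The bit pattern 000 belongs to no part of a segment, so the very first tuple is free for the
     initial push. *)
  have -> : g (nseq word_width ord0) = None.
    rewrite /g /= /rule_cases /=; case: (R _ _ _) => //=.
    have nz i : nth ord0 (slice (d + k + k + k) 3 (nseq word_width ord0)) i = (ord0 : 'I_n.+2).
      apply/eqP; case: (ltnP i (size (slice (d + k + k + k) 3 (nseq word_width (ord0 : 'I_n.+2))))) => h.
        have /allP/(_ _ (mem_nth ord0 h)) // : all (pred1 ord0) (slice (d + k + k + k) 3 (nseq word_width (ord0 : 'I_n.+2))).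
        by apply/allP => x /mem_take/mem_drop/nseqP[->].
      by rewrite nth_default.
    by rewrite !nz.
  congr cons; apply/eq_in_pmap => v vs.
  by rewrite /word_letter /g /word_cases /= gtn_eqF // s0.
congr cons; rewrite pmap_lexs_cat.
have -> : n.+2 ^ d = size (lexs n.+2 d) by rewrite -(size_map (@lexval n.+2)) map_lexval size_iota.
rewrite -map_const; congr flatten; apply/eq_in_map => t /size_lexs st.
rewrite pmap_lexs_cat /edges flatten_segments; congr flatten.
apply/eq_in_map => A /size_lexs sA /=.
rewrite pmap_lexs_cat flatten_segments; congr flatten.
apply/eq_in_map => B /size_lexs sB /=.
rewrite pmap_lexs_cat flatten_segments; congr flatten.
apply/eq_in_map => C /size_lexs sC /=.
rewrite -pmap_rule_cases //; apply/eq_in_pmap => v /size_lexs sv; rewrite /g.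
rewrite -!addnA !(slice_catD _ _ _ st) (slice_cat _ _ st).
rewrite !(slice_catD _ _ _ sA) !(slice_cat _ _ sA) (slice0_cat _ sA).
rewrite !(slice_catD _ _ _ sB) !(slice_cat _ _ sB) (slice0_cat _ sB).
by rewrite !(slice_catD _ _ _ sC) !(slice_cat _ _ sC) (slice0_cat _ sC).
Qed.

Lemma edgesP e : reflect
  (exists A B C, [/\ [/\ size A = k, size B = k & size C = k], R A B C & e = edge A B C])
  (e \in edges).
Proof.
apply: (iffP flatten_mapP) => [[A /size_lexs sA]|[A [B [C [[sA sB sC] r ->]]]]].
  move=> /flatten_mapP[B /size_lexs sB /flatten_mapP[C /size_lexs sC]].
  by case: ifP => // r; rewrite inE => /eqP->; exists A, B, C.
exists A; first by rewrite mem_lexs sA.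
apply/flatten_mapP; exists B; first by rewrite mem_lexs sB.
by apply/flatten_mapP; exists C; rewrite ?mem_lexs ?sC // r inE.
Qed.

Inductive dtree : V -> nat -> Prop :=
| dtree_triv A : triv A -> dtree A 0
| dtree_rule A B C m1 m2 : [/\ size A = k, size B = k & size C = k] -> R A B C ->
    dtree B m1 -> dtree C m2 -> dtree A (m1 + m2).+1.

(** Every goal is treated sooner or later, and a rank determines its tuple, so the rule applied to a
    number is a rule for the intended node. *)
Lemma solve_dtree gl m : solve edges gl m ->
  {in gl, forall r A, size A = k -> lexval A = r -> exists p, dtree A p}.
Proof.
elim=> {gl m} // a rs gl m /edgesP[A [B [C [[sA sB sC] r e]]]] _ IH b.
have ea : a = lexval A by case: e.
have ers : rs = [seq lexval X | X <- [:: B; C] & ~~ triv X] by case: e.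
rewrite inE => /predU1P[-> A' sA' eA'|bgl]; last first.
  by apply: IH; rewrite mem_cat bgl orbT.
have -> : A' = A by apply: (@lexval_inj n.+2 k); rewrite ?mem_lexs ?sA ?sA' // eA'.
have sub X : X \in [:: B; C] -> exists p, dtree X p.
  move=> XBC; case tX : (triv X); first by exists 0; exact: dtree_triv.
  apply: (IH (lexval X)) => //.
    by rewrite mem_cat ers; apply/orP; left; apply: map_f; rewrite mem_filter tX.
  by move: XBC; rewrite !inE => /orP[]/eqP->.
have [p dB] := sub B (mem_head _ _).
have [q dC] : exists q, dtree C q by apply: sub; rewrite !inE eqxx orbT.
by exists (p + q).+1; apply: dtree_rule r dB dC.
Qed.

(** The goals [gl] below A are carried along so that the resolutions of C and then B can be stacked.
    The count is only bounded because a trivial A may also have a derivation by rules, which is then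
    dropped. *)
Lemma dtree_solve A m gl p : dtree A m -> solve edges gl p ->
  exists2 q, q <= m + p &
    solve edges ([seq lexval X | X <- [:: A] & ~~ triv X] ++ gl) q.
Proof.
move=> dA; elim: dA gl p => {A m} [A tA|A B C m1 m2 sz r _ IHB _ IHC] gl p h.
  by exists p; rewrite //= tA.
case tA : (triv A); first by exists p; rewrite /= ?tA // leq_addl.
have [q qp {}h] := IHC _ _ h; have [q' q'q {}h] := IHB _ _ h.
exists q'.+1; first by rewrite addSn ltnS -addnA (leq_trans q'q) // leq_add2l.
rewrite /= tA /=; apply: (@solve_cons _ _ (edge A B C).2).
  by apply/edgesP; exists A, B, C.
move: h; rewrite /edge /=; case: (triv B); case: (triv C) => //=.
Qed.

Lemma Run_dtree : Run (pmap word_letter (lexs n.+2 word_width)) [::] [::] ->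
  exists m, dtree (nseq k ord0) m.
Proof.
rewrite pmap_word_letter => /Run_word[m /solve_dtree h].
apply: (h 0); rewrite ?mem_head ?size_nseq //.
by apply/eqP; rewrite lexval_eq0 all_nseq /= orbT.
Qed.

Lemma dtree_Run m : dtree (nseq k ord0) m -> m <= n.+2 ^ d -> ~~ triv (nseq k ord0) ->
  Run (pmap word_letter (lexs n.+2 word_width)) [::] [::].
Proof.
move=> /dtree_solve/(_ (solve_nil _))[q]; rewrite addn0 => qm.
move=> h md nt; move: h; rewrite pmap_word_letter /= nt /=.
have /eqP-> : lexval (nseq k (ord0 : 'I_n.+2)) == 0.
  by rewrite lexval_eq0 all_nseq /= orbT.
by move/Run_word_of_solve; apply; exact: leq_trans md.
Qed.

End Word.

(** * First-order formulas *)

Lemma lexval_max N (u : seq 'I_N.+1) :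
  ((lexval u).+1 == N.+1 ^ size u) = all (pred1 ord_max) u.
Proof.
elim: u => //= x u <-; have := lexval_lt u; rewrite expnS; set M := _ ^ _ => lt.
have xN := ltn_ord x; rewrite -val_eqE /=.
move: (lexval u) (x : nat) lt xN => U y; move: M; clear => M UM yN.
apply/eqP/andP=> [e|[/eqP-> /eqP<-]]; last by rewrite -addnS mulSn addnC.
have y_eq : y = N.
  apply/eqP; rewrite eqn_leq -ltnS yN /= leqNgt; apply/negP => lt.
  have : y.+1 * M <= N * M by rewrite leq_mul2r lt orbT.
  by move: e; rewrite !mulSn; lia.
by split; apply/eqP=> //; move: e; rewrite y_eq mulSn; lia.
Qed.

(** Addition of one with carry, expressed by equality and successor of single coordinates, hence
    definable from the order. *)
Lemma lexval_succ N (x y : 'I_N.+1) (u v : seq 'I_N.+1) : size u = size v ->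
  (lexval (y :: v) == (lexval (x :: u)).+1) =
  (x == y) && (lexval v == (lexval u).+1) ||
  [&& y == x.+1 :> nat, all (pred1 ord_max) u & all (pred1 ord0) v].
Proof.
move=> s; rewrite -lexval_max -lexval_eq0 /= -s -val_eqE /=.
have := lexval_lt v; have := lexval_lt u; rewrite -s.
move: (lexval u) (lexval v) (x : nat) (y : nat) (_ ^ _) => U V {}x {}y M UM VM.
case: (ltngtP x.+1 y) => [lt|lt|<-].
- have : x.+2 * M <= y * M by rewrite leq_mul2r lt orbT.
  by rewrite !mulSn; lia.
- case: (eqVneq x y) => [->|ne]; first by lia.
  have {}lt : y < x by rewrite ltn_neqAle eq_sym ne.
  have : y.+1 * M <= x * M by rewrite leq_mul2r lt orbT.
  by rewrite !mulSn; lia.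
- by rewrite mulSn; lia.
Qed.

Section Formulas.

Variable A : finType.

Definition fConst m (b : bool) : formula A m :=
  if b then Equal A Min Min else Not (Equal A Min Min).

Lemma sat_fConst n (w : n.+1.-tuple A) m b v : sat w (@fConst m b) v = b.
Proof. by case: b. Qed.

Definition fAll m (fs : seq (formula A m)) := foldr (@And A m) (fConst m true) fs.
Definition fHas m (fs : seq (formula A m)) := foldr (@Or A m) (fConst m false) fs.

Lemma sat_fAll n (w : n.+1.-tuple A) m (fs : seq (formula A m)) v :
  sat w (fAll fs) v = all (fun f => sat w f v) fs.
Proof. by elim: fs => [|f fs IH] /=; rewrite ?IH ?eqxx. Qed.

Lemma sat_fHas n (w : n.+1.-tuple A) m (fs : seq (formula A m)) v :
  sat w (fHas fs) v = has (fun f => sat w f v) fs.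
Proof. by elim: fs => [|f fs IH] /=; rewrite ?IH ?eqxx. Qed.

Fixpoint fLexlt m (ts us : seq (term m)) : formula A m :=
  match ts, us with
  | t :: ts', u :: us' => Or (Less A t u) (And (Equal A t u) (fLexlt ts' us'))
  | _, _ => fConst m false
  end.

Fixpoint fEqs m (ts us : seq (term m)) : formula A m :=
  match ts, us with
  | t :: ts', u :: us' => And (Equal A t u) (fEqs ts' us')
  | _, _ => fConst m true
  end.

Definition lift_term m (t : term m) : term m.+1 :=
  match t with Var i => Var (lift ord0 i) | Min => Min | Max => Max end.

Definition fSucc m (t u : term m) : formula A m :=
  And (Less A t u) (Not (Exists (And (Less A (lift_term t) (Var ord0))
                                     (Less A (Var ord0) (lift_term u))))).

Fixpoint fLexsucc m (ts us : seq (term m)) : formula A m :=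
  match ts, us with
  | t :: ts', u :: us' =>
      Or (And (Equal A t u) (fLexsucc ts' us'))
         (And (fSucc t u) (And (fEqs ts' (nseq (size ts') Max))
                               (fEqs us' (nseq (size us') Min))))
  | _, _ => fConst m false
  end.

Definition term_vals n m (v : m.-tuple 'I_n.+1) (ts : seq (term m)) :=
  map (term_val v) ts.

Lemma term_val_lift n m (v : m.-tuple 'I_n.+1) x t :
  term_val [tuple of x :: v] (lift_term t) = term_val v t.
Proof. by case: t => //= i; rewrite tnthS. Qed.

Lemma term_vals_lift n m (v : m.-tuple 'I_n.+1) x ts :
  term_vals [tuple of x :: v] (map (@lift_term m) ts) = term_vals v ts.
Proof. by rewrite /term_vals -map_comp; apply: eq_map => t; exact: term_val_lift. Qed.

Section Sat.

Variables (n : nat) (w : n.+1.-tuple A) (m : nat) (v : m.-tuple 'I_n.+1).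
Implicit Types ts us : seq (term m).

Lemma sat_fEqs ts us : size ts = size us ->
  sat w (fEqs ts us) v = (term_vals v ts == term_vals v us).
Proof.
elim: ts us => [|t ts IH] [|u us] //=.
by move=> [/IH->]; rewrite eqseq_cons.
Qed.

Lemma sat_fLexlt ts us : size ts = size us ->
  sat w (fLexlt ts us) v = (lexval (term_vals v ts) < lexval (term_vals v us)).
Proof.
elim: ts us => [|t ts IH] [|u us] //=.
move=> [s]; rewrite IH // -/(term_vals v ts) -/(term_vals v us).
have := lexval_lt (term_vals v ts); have := lexval_lt (term_vals v us).
rewrite !size_map s; set N := _ ^ _; set x := term_val v t; set y := term_val v u.
move: (lexval _) (lexval _) => U V UN VN; rewrite -val_eqE /=.
case: (ltngtP (x : nat) y) => [xy|yx|->] /=.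
- apply/esym; apply: (@leq_trans (x.+1 * N)); first by rewrite mulSn addnC ltn_add2r.
  by apply: leq_trans (leq_addr _ _); rewrite leq_mul2r xy orbT.
- apply/esym/negbTE; rewrite -leqNgt; apply: (@leq_trans (y.+1 * N)).
    by rewrite mulSn addnC leq_add2r ltnW.
  by apply: leq_trans (leq_addr _ _); rewrite leq_mul2r yx orbT.
- by rewrite ltn_add2l.
Qed.

Lemma sat_fSucc t u : sat w (fSucc t u) v = (term_val v u == (term_val v t).+1 :> nat).
Proof.
rewrite /= ; apply/andP/eqP=> [[lt /existsPn h]|e].
  apply/eqP; rewrite eqn_leq lt andbT leqNgt; apply/negP => h2.
  have lt3 : (term_val v t).+1 < n.+1 by exact: ltn_trans h2 (ltn_ord _).
  have := h (Ordinal lt3).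
  by rewrite /= !term_val_lift ltnSn h2.
rewrite e ltnSn; split=> //; apply/existsPn => x; rewrite /= !term_val_lift tnth0 e ltnS.
by apply/negP => /andP[h1 h2]; move: h1; rewrite ltnNge h2.
Qed.

Lemma sat_fLexsucc ts us : size ts = size us ->
  sat w (fLexsucc ts us) v =
  (lexval (term_vals v us) == (lexval (term_vals v ts)).+1).
Proof.
elim: ts us => [|t ts IH] [|u us] // [s].
rewrite [term_vals v (t :: ts)]/= [term_vals v (u :: us)]/= lexval_succ ?size_map //.
have e ts' c : (term_vals v ts' == term_vals v (nseq (size ts') c)) =
    all (pred1 (term_val v c)) (term_vals v ts').
  by elim: ts' => //= t' ts' <-; rewrite eqseq_cons.
rewrite -IH // -(e ts Max) -(e us Min) -!sat_fEqs ?size_nseq // -sat_fSucc //.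
Qed.

End Sat.
End Formulas.

(** The quantifier ranks its formulas by the enumeration of the alphabet, whereas the cases have a
    priority of their own. The formula for g says that the selected case has label g; these formulas
    exclude each other, so their order does not matter. *)
Lemma lindstrom_cases (A T : finType) (U : Type) (lab : U -> T) (bs : seq T) (b : T) K
    (cs : seq (formula A K * U)) (d : U) : enum T = rcons bs b ->
  exists2 phis : seq (formula A K), size phis = size bs & forall n (w : n.+1.-tuple A),
    lindstrom_word bs b phis w =
    [seq lab (first_case [seq (sat w c.1 X, c.2) | c <- cs] d) | X <- lex_tuples n.+1 K].
Proof.
move=> eT.
pose phi g := foldr (fun c f => Or (And c.1 (fConst A K (lab c.2 == g))) (And (Not c.1) f))
  (fConst A K (lab d == g)) cs.
exists [seq phi g | g <- bs] => [|n w]; first by rewrite size_map.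
apply: eq_map => X; set t := lab _.
have phiE g : sat w (phi g) X = (t == g).
  rewrite /phi /t; elim: (cs) => [|[f u] cs' IH] /=; first exact: sat_fConst.
  by rewrite sat_fConst IH; case: (sat w f X); rewrite /= ?orbF.
have ub : uniq (rcons bs b) by rewrite -eT enum_uniq.
have tin : t \in rcons bs b by rewrite -eT mem_enum.
rewrite (_ : find _ _ = index t bs); last first.
  rewrite find_map /index; apply: eq_find => g /=.
  by rewrite phiE eq_sym.
(* The last letter has no formula and is obtained as the default of [nth]. *)
case: (boolP (t \in bs)) => tbs; first by rewrite nth_index.
move: tin; rewrite mem_rcons inE (negPf tbs) orbF => /eqP <-.
by rewrite nth_default // memNindex.
Qed.

Section Horn.

Inductive atom (A : Type) :=
| Zero of nat | Eq of nat & nat | Succ of nat & nat | Reads of nat & input_symbol A.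

Variable A : finType.

(* Junk value: an index out of range denotes the number 0. *)
Definition atom_sem (w : seq A) (vals : seq nat) (a : atom A) : bool :=
  match a with
  | Zero i => nth 0 vals i == 0
  | Eq i j => nth 0 vals i == nth 0 vals j
  | Succ i j => nth 0 vals j == (nth 0 vals i).+1
  | Reads i LeftEnd => nth 0 vals i == 0
  | Reads i RightEnd => size w < nth 0 vals i
  | Reads i (Input a) =>
      (0 < nth 0 vals i) && (onth w (nth 0 vals i).-1 == Some a)
  end.

(** A number has k0 + 1 digits, and a position of the word is padded with minimal digits. Positions
    count from 0 but the first letter is in cell 1 of the tape, so the cell is the successor of the
    position; a nonzero cell that is no such successor lies at the right end. *)
Definition fAtom k0 m (fields : seq (seq (term m))) (a : atom A) : formula A m :=
  let fd i := nth (nseq k0.+1 Min) fields i in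
  let zero i := fEqs A (fd i) (nseq k0.+1 Min) in
  let fd_succ i := fLexsucc A (rcons (nseq k0 Min) (Var ord0)) (map (@lift_term m) (fd i)) in
  match a with
  | Zero i => zero i
  | Eq i j => fEqs A (fd i) (fd j)
  | Succ i j => fLexsucc A (fd i) (fd j)
  | Reads i LeftEnd => zero i
  | Reads i RightEnd => And (Not (zero i)) (Not (Exists (fd_succ i)))
  | Reads i (Input a) => Exists (And (Letter a (Var ord0)) (fd_succ i))
  end.

Lemma lexval_rcons n k0 (z : 'I_n.+1) : lexval (rcons (nseq k0 ord0) z) = z.
Proof. by elim: k0 => [|k0 IH] /=; rewrite ?muln1 ?addn0 // IH. Qed.

Lemma lexval_nseq0 n k0 : lexval (nseq k0 (ord0 : 'I_n.+1)) = 0.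
Proof. by apply/eqP; rewrite lexval_eq0 all_nseq /= orbT. Qed.

Lemma sat_fAtom k0 n (w : n.+1.-tuple A) m (fields : seq (seq (term m))) v a :
  all (fun f => size f == k0.+1) fields ->
  sat w (fAtom k0 fields a) v =
  atom_sem w [seq lexval (term_vals v f) | f <- fields] a.
Proof.
move=> sz; set vals := map _ _.
pose fd i := nth (nseq k0.+1 Min) fields i.
have sfd i : size (fd i) = k0.+1.
  rewrite /fd; case: (ltnP i (size fields)) => h; last by rewrite nth_default ?size_nseq.
  by apply/eqP; exact: (all_nthP (nseq k0.+1 Min) sz).
have tv0 r : term_vals v (nseq r Min) = nseq r ord0 by exact: map_nseq.
have fdE i : lexval (term_vals v (fd i)) = nth 0 vals i.
  rewrite /vals /fd; case: (ltnP i (size fields)) => h; first by rewrite (nth_map (nseq k0.+1 Min)).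
  by rewrite !nth_default ?size_map // tv0 lexval_nseq0.
have inj f g : size f = k0.+1 -> size g = k0.+1 ->
    (term_vals v f == term_vals v g) = (lexval (term_vals v f) == lexval (term_vals v g)).
  move=> sf sg; apply/eqP/eqP=> [->//|]; apply: (@lexval_inj n.+1 k0.+1);
  by rewrite mem_lexs size_map ?sf ?sg.
have zeroE i : sat w (fEqs A (fd i) (nseq k0.+1 Min)) v = (nth 0 vals i == 0).
  by rewrite sat_fEqs ?inj ?sfd ?size_nseq // fdE tv0 lexval_nseq0.
have succE i z : sat w (fLexsucc A (rcons (nseq k0 Min) (Var ord0)) (map (@lift_term m) (fd i)))
    [tuple of z :: v] = (nth 0 vals i == z.+1).
  rewrite sat_fLexsucc ?size_map ?size_rcons ?size_nseq ?sfd //.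
  rewrite term_vals_lift fdE /term_vals map_rcons map_nseq lexval_rcons.
  by rewrite /= tnth0.
case: a => [i|i j|i j|i [||a]] /=; rewrite -?/(fd _) //.
- by rewrite sat_fEqs ?sfd // inj ?sfd // !fdE.
- by rewrite sat_fLexsucc ?sfd // !fdE.
- rewrite zeroE (_ : size w = n.+1) ?size_tuple //.
  apply/andP/idP=> [[nz /existsPn h]|h].
    rewrite ltnNge; apply/negP => le; case e : (nth 0 vals i) nz le => [|z] // _ zn.
    by have := h (Ordinal zn); rewrite succE e /= eqxx.
  split; first by case: (nth _ _ _) h.
  apply/existsPn => z; rewrite succE; apply/negP => /eqP e.
  by move: h; rewrite e ltnS leqNgt ltn_ord.
- apply/existsP/andP=> [[z]|].
    rewrite /= tnth0 succE => /andP[/eqP wz /eqP->]; split=> //=.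
    by rewrite onthE (nth_map a) ?size_tuple // -tnth_nth wz.
  case e : (nth 0 vals i) => [|z] [] //= _ /eqP wz.
  have zn : z < n.+1.
    by rewrite -(size_tuple w) ltnNge; apply/negP => h; move: wz; rewrite onth_default.
  exists (Ordinal zn); rewrite /= succE e /= tnth0 eqxx andbT.
  by move: wz; rewrite onthE (nth_map a) ?size_tuple // => -[] /eqP; rewrite (tnth_nth a).
Qed.

End Horn.

(** * Path systems on tagged tuples of numbers *)

Record horn (A : finType) := Horn {
  htag : finType;
  hroot : htag;
  htop : htag;
  hroot_htop : hroot != htop;
  clauses : htag -> htag -> htag -> seq (seq (atom A))
}.

(* A node carries six numbers. The clauses for the tags tA, tB, tC are alternative conditions on the
   eighteen numbers of the nodes in a rule A <- B, C. The root has all its numbers equal to 0. *)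
Definition is_fields (N : nat) (a : seq nat) := (size a == 6) && all (fun x => x < N) a.

Inductive prf (A : finType) (H : horn A) (w : seq A) (N : nat) :
    htag H -> seq nat -> nat -> Prop :=
| prf_top a : is_fields N a -> prf w N (htop H) a 0
| prf_rule tA tB tC a b c m1 m2 :
    [/\ is_fields N a, is_fields N b & is_fields N c] ->
    has (all (atom_sem w (a ++ b ++ c))) (clauses tA tB tC) ->
    prf w N tB b m1 -> prf w N tC c m2 -> prf w N tA a (m1 + m2).+1.

(** * Tagged nodes as tuples of positions *)

Section Nodes.

Variables (A : finType) (H : horn A) (k0 : nat).
Local Notation T := (htag H).

Definition node_width := size (enum T) + 6 * k0.+1.

(* The root has the tag part with only minimal coordinates, whence the rank 0. *)
Definition onehot U (lo hi : U) (t : T) : seq U :=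
  [seq if (t' == t) && (t' != hroot H) then hi else lo | t' <- enum T].

Definition tag_part U (X : seq U) := slice 0 (size (enum T)) X.
Definition node_fields U (X : seq U) : seq (seq U) :=
  [seq slice (size (enum T) + i * k0.+1) k0.+1 X | i <- iota 0 6].

Lemma map_slice U U' (f : U -> U') o l X : map f (slice o l X) = slice o l (map f X).
Proof. by rewrite /slice map_take map_drop. Qed.

Lemma size_slice U o l (X : seq U) : o + l <= size X -> size (slice o l X) = l.
Proof.
by move=> h; rewrite size_takel // size_drop leq_subRL // (leq_trans _ h) // leq_addr.
Qed.

Lemma size_onehot U (lo hi : U) t : size (onehot lo hi t) = size (enum T).
Proof. by rewrite size_map. Qed.

Lemma size_tag_part U (X : seq U) : size X = node_width ->
  size (tag_part X) = size (enum T).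
Proof. by move=> s; rewrite size_slice // s leq_addr. Qed.

Lemma size_node_fields U (X : seq U) : size X = node_width ->
  all (fun f => size f == k0.+1) (node_fields X).
Proof.
move=> s; rewrite all_map; apply/allP => i; rewrite mem_iota /= => i6.
by rewrite size_slice // s /node_width -addnA leq_add2l addnC -mulSn leq_mul2r i6 orbT.
Qed.

Section Sem.

Variable n : nat.
Local Notation N := (n.+2 ^ k0.+1).
Local Notation V := (seq 'I_n.+2).
Implicit Types X Y Z : V.

Definition has_tag X t := tag_part X == onehot ord0 ord_max t.
Definition field_vals X := [seq lexval f | f <- node_fields X].

Lemma has_tag_inj X t t' : has_tag X t -> has_tag X t' -> t = t'.
Proof.
rewrite /has_tag => /eqP-> /eqP/eq_in_map e.
have h u : (u == t) && (u != hroot H) = (u == t') && (u != hroot H).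
  by have := e u (mem_enum _ u); do 2 case: ifP.
case: (eqVneq t (hroot H)) => [tr|tr]; last first.
  by have := h t; rewrite eqxx tr !andbT /= => /esym/eqP.
case: (eqVneq t' (hroot H)) => [->//|t'r].
by have := h t'; rewrite eqxx t'r tr (negPf t'r).
Qed.

Lemma is_fields_field_vals X : size X = node_width -> is_fields N (field_vals X).
Proof.
move=> /size_node_fields h; apply/andP; split; first by rewrite !size_map.
by rewrite all_map; apply: sub_all h => f /= /eqP <-; exact: lexval_lt.
Qed.

Lemma node_exists t a : is_fields N a ->
  exists X, [/\ size X = node_width, has_tag X t & field_vals X = a].
Proof.
move=> /andP[/eqP sa lt].
have [F [sF eF]] : exists F : V, size F = size a * k0.+1 /\
    forall i, i < size a -> lexval (slice (i * k0.+1) k0.+1 F) = nth 0 a i.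
  elim: a lt {sa} => [|x a IH] /=; first by exists [::].
  move=> /andP[/lexval_surj[u su eu] /IH[F [sF eF]]]; exists (u ++ F).
  split=> [|[|i]] /=; first by rewrite size_cat sF su mulSn.
    by rewrite mul0n slice0_cat.
  by rewrite ltnS mulSn (slice_catD _ _ _ su) => /eF.
have so : size (onehot (ord0 : 'I_n.+2) ord_max t) = size (enum T) by exact: size_onehot.
exists (onehot ord0 ord_max t ++ F); split.
- by rewrite size_cat so sF sa.
- by rewrite /has_tag /tag_part slice0_cat.
- apply: (@eq_from_nth _ 0) => [|i]; rewrite !size_map size_iota ?sa // => i6.
  rewrite (nth_map [::]) ?size_map ?size_iota // (nth_map 0) ?size_iota // nth_iota //.
  by rewrite add0n (slice_catD _ _ _ so) eF // sa.
Qed.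

Lemma root_node : has_tag (nseq node_width ord0) (hroot H) /\
  field_vals (nseq node_width ord0) = nseq 6 0.
Proof.
have sl o l : o + l <= node_width ->
    slice o l (nseq node_width (ord0 : 'I_n.+2)) = nseq l ord0.
  by move=> h; rewrite /slice drop_nseq take_nseq // leq_subRL // (leq_trans _ h) // leq_addr.
split.
  rewrite /has_tag /tag_part sl ?leq_addr // -map_const; apply/eqP/eq_map => t /=.
  by case: eqP.
rewrite /field_vals /node_fields -map_comp -[nseq 6 0]/[seq 0 | _ <- iota 0 6].
apply/eq_in_map => i; rewrite mem_iota /= => i6; rewrite sl ?lexval_nseq0 //.
by rewrite /node_width -addnA leq_add2l addnC -mulSn leq_mul2r i6 orbT.
Qed.

Definition node_rule (w : seq A) X Y Z : bool :=
  has (fun tA => has (fun tB => has (fun tC =>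
    [&& has_tag X tA, has_tag Y tB, has_tag Z tC &
      has (all (atom_sem w (field_vals X ++ field_vals Y ++ field_vals Z))) (clauses tA tB tC)])
  (enum T)) (enum T)) (enum T).

Lemma node_ruleP w X Y Z : reflect
  (exists tA tB tC, [/\ has_tag X tA, has_tag Y tB, has_tag Z tC &
      has (all (atom_sem w (field_vals X ++ field_vals Y ++ field_vals Z))) (clauses tA tB tC)])
  (node_rule w X Y Z).
Proof.
apply: (iffP hasP) => [[tA _ /hasP[tB _ /hasP[tC _ /and4P[]]]]|].
  by exists tA, tB, tC.
move=> [tA [tB [tC [hA hB hC h]]]].
exists tA; first exact: mem_enum; apply/hasP; exists tB; first exact: mem_enum.
by apply/hasP; exists tC; [exact: mem_enum|apply/and4P].
Qed.

Local Notation tree w := (dtree node_width (node_rule w) (fun X => has_tag X (htop H))).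

Lemma dtree_prf w X m : tree w X m -> size X = node_width ->
  forall t, has_tag X t -> prf w N t (field_vals X) m.
Proof.
elim=> {X m} [X hX sX t ht|X Y Z m1 m2 [_ sY sZ] /node_ruleP[tA [tB [tC [hA hB hC h]]]]].
  by rewrite (has_tag_inj ht hX); apply: prf_top; exact: is_fields_field_vals.
move=> _ IH1 _ IH2 sX t ht; rewrite (has_tag_inj ht hA).
by apply: prf_rule h (IH1 sY _ hB) (IH2 sZ _ hC); split; exact: is_fields_field_vals.
Qed.

Lemma prf_dtree w t a m : prf w N t a m ->
  forall X, size X = node_width -> has_tag X t -> field_vals X = a -> tree w X m.
Proof.
elim=> {t a m} [a _ X _ hX _|tA tB tC a b c m1 m2 [_ fb fc] h _ IH1 _ IH2 X sX hX eX].
  exact: dtree_triv.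
have [Y [sY hY eY]] := node_exists tB fb; have [Z [sZ hZ eZ]] := node_exists tC fc.
apply: (@dtree_rule _ _ _ _ X Y Z) => //; [|exact: IH1|exact: IH2].
by apply/node_ruleP; exists tA, tB, tC; rewrite eX eY eZ.
Qed.

End Sem.
End Nodes.

(** * Definability of the word *)

Section WordFormulas.

Variables (A : finType) (H : horn A) (k0 d : nat).
Local Notation T := (htag H).
Local Notation k := (node_width H k0).
Local Notation K := (word_width d k).
Local Notation F := (formula A K).
Local Notation terms := (seq (term K)).

Definition fTag (X : terms) (t : T) : F := fEqs A (tag_part H X) (onehot Min Max t).

Definition fRule (X Y Z : terms) : F :=
  fHas [seq fHas [seq fHas [seq
    And (fTag X tA) (And (fTag Y tB) (And (fTag Z tC)
      (fHas [seq fAll [seq fAtom k0 (node_fields H k0 X ++ node_fields H k0 Y ++ node_fields H k0 Z) a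
        | a <- cl] | cl <- clauses tA tB tC])))
    | tC <- enum T] | tB <- enum T] | tA <- enum T].

Definition fZero (j : terms) : F := fEqs A j (nseq (size j) Min).

Definition fSegment_cases (X Y Z p j : terms) : seq (F * option letter) :=
  let lo i := Equal A (nth Min p i) Min in
  let hi i := Equal A (nth Min p i) Max in
  [:: (fAll [:: lo 0; lo 1; hi 2; fZero j], Some SegL);
      (fAll [:: lo 0; hi 1; lo 2; fLexlt A j X], Some (Pop true));
      (fAll [:: lo 0; hi 1; lo 2; fEqs A j X], Some (Pop false));
      (fAll [:: lo 0; hi 1; hi 2; Not (fTag Z (htop H)); fZero j], Some (Push false));
      (fAll [:: lo 0; hi 1; hi 2; Not (fTag Z (htop H)); Not (fLexlt A Z j)], Some (Push true));
      (fAll [:: hi 0; lo 1; lo 2; Not (fTag Y (htop H)); fZero j], Some (Push false));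
      (fAll [:: hi 0; lo 1; lo 2; Not (fTag Y (htop H)); Not (fLexlt A Y j)], Some (Push true));
      (fAll [:: hi 0; lo 1; hi 2; fZero j], Some SegR)].

Definition all_vars : terms := [seq Var i | i <- enum 'I_K].

Definition fWord_cases : seq (F * option letter) :=
  let X := slice d k all_vars in
  let Y := slice (d + k) k all_vars in
  let Z := slice (d + k + k) k all_vars in
  (fZero all_vars, Some (Push false)) :: (Not (fRule X Y Z), None) ::
  fSegment_cases X Y Z (slice (d + k + k + k) 3 all_vars) (slice (d + k + k + k + 3) k all_vars).

Variables (n : nat) (w : n.+2.-tuple A) (v : K.-tuple 'I_n.+2).
Local Notation tv := (term_vals v).

Lemma term_vals_all_vars : tv all_vars = val v.
Proof. by rewrite /term_vals /all_vars -map_comp -[RHS]map_tnth_enum. Qed.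

Lemma eq_term_vals l (X Y : terms) : size X = l -> size Y = l ->
  (tv X == tv Y) = (lexval (tv X) == lexval (tv Y)).
Proof.
move=> sX sY; apply/eqP/eqP=> [->//|]; apply: (@lexval_inj n.+2 l);
by rewrite mem_lexs size_map ?sX ?sY.
Qed.

Lemma sat_fZero j : sat w (fZero j) v = (lexval (tv j) == 0).
Proof.
rewrite sat_fEqs ?size_nseq // (@eq_term_vals (size j)) ?size_nseq //.
by rewrite [tv (nseq _ _)]map_nseq lexval_nseq0.
Qed.

Lemma sat_fTag X t : size X = k -> sat w (fTag X t) v = has_tag (tv X) t.
Proof.
move=> sX; rewrite sat_fEqs ?size_onehot ?(size_tag_part sX) //.
rewrite /has_tag /tag_part -map_slice /term_vals; congr (_ == _).
by rewrite -map_comp; apply: eq_map => t' /=; case: ifP.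
Qed.

Lemma field_vals_term_vals X :
  [seq lexval (tv f) | f <- node_fields H k0 X] = field_vals H k0 (tv X).
Proof.
rewrite /field_vals /node_fields -!map_comp; apply: eq_map => i /=.
by rewrite /term_vals map_slice.
Qed.

Lemma sat_fRule X Y Z : size X = k -> size Y = k -> size Z = k ->
  sat w (fRule X Y Z) v = node_rule H k0 w (tv X) (tv Y) (tv Z).
Proof.
move=> sX sY sZ; rewrite /fRule /node_rule.
rewrite sat_fHas has_map; apply: eq_has => tA; rewrite /= sat_fHas has_map.
apply: eq_has => tB; rewrite /= sat_fHas has_map; apply: eq_has => tC /=.
rewrite !sat_fTag //; do 3 congr andb; rewrite sat_fHas has_map; apply: eq_has => cl /=.
rewrite sat_fAll all_map; apply: eq_all => a /=.
have sz : all (fun f => size f == k0.+1)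
    (node_fields H k0 X ++ node_fields H k0 Y ++ node_fields H k0 Z).
  by rewrite !all_cat !size_node_fields.
have e : [seq lexval (tv f) | f <- node_fields H k0 X ++ node_fields H k0 Y ++ node_fields H k0 Z]
    = field_vals H k0 (tv X) ++ field_vals H k0 (tv Y) ++ field_vals H k0 (tv Z).
  by rewrite !map_cat !field_vals_term_vals.
exact: etrans (sat_fAtom w v a sz) (congr1 (fun u => atom_sem w u a) e).
Qed.

Lemma fWord_casesE :
  [seq (sat w c.1 v, c.2) | c <- fWord_cases] =
  word_cases d k (node_rule H k0 w) (fun X => has_tag X (htop H)) (val v).
Proof.
have sv : size all_vars = K by rewrite size_map size_enum_ord.
rewrite /fWord_cases /word_cases -term_vals_all_vars /term_vals -!(map_slice (term_val v)).
have sz o l : o + l <= K -> size (slice o l all_vars) = l.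
  by move=> h; rewrite size_slice // sv.
have wd : K = d + k + k + k + 3 + k by rewrite /word_width !addnA.
set X := slice d k _; set Y := slice (d + k) k _; set Z := slice (d + k + k) k _.
set p := slice _ 3 _; set j := slice _ k _.
have sX : size X = k by apply: sz; rewrite wd; lia.
have sY : size Y = k by apply: sz; rewrite wd; lia.
have sZ : size Z = k by apply: sz; rewrite wd; lia.
have sj : size j = k by apply: sz; rewrite wd; lia.
rewrite /= /fSegment_cases /segment_cases.
have nthp i : nth ord0 [seq term_val v t | t <- p] i = term_val v (nth Min p i).
  case: (ltnP i (size p)) => h; first by rewrite (nth_map Min).
  by rewrite !nth_default ?size_map.
rewrite sat_fZero sat_fRule // !sat_fTag // !sat_fLexlt ?sj ?sX ?sY ?sZ //.
rewrite !sat_fEqs ?sj ?sX ?sY ?sZ ?size_nseq //.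
have -> : (tv j == tv (nseq k Min)) = (lexval (tv j) == 0).
  rewrite (@eq_term_vals k) ?size_nseq //.
  by rewrite [tv (nseq _ _)]map_nseq lexval_nseq0.
rewrite (@eq_term_vals k) // -!leqNgt !eqxx !andbT.
by rewrite /rule_cases /segment_cases !nthp.
Qed.

End WordFormulas.

Lemma size_lexs1 K : size (lex_tuples 1 K) = 1.
Proof.
have := congr1 size (map_lexval 1 K).
by rewrite size_map size_map size_iota exp1n.
Qed.

(** Bits and powers of n need at least two positions; words of length 1 are settled by a finite
    table indexed by their letter. *)
Lemma horn_in_QFO (A : finType) (L : language A) (H : horn A) (k0 d : nat) :
  (forall w, 1 < size w -> L w -> exists2 m, m <= size w ^ d &
     prf w (size w ^ k0.+1) (hroot H) (nseq 6 0) m) ->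
  (forall w m, 1 < size w -> prf w (size w ^ k0.+1) (hroot H) (nseq 6 0) m -> L w) ->
  in_QFO the_groupoid L.
Proof.
move=> complete sound.
have [bs [b eG]] : exists bs b, enum the_groupoid = rcons bs b.
  case/lastP: (enum the_groupoid) (mem_enum the_groupoid (set0 : {set nt})) => // bs b _.
  by exists bs, b.
pose K := word_width d (node_width H k0).
(* In a word of length 1 all tuples coincide; it gets the neutral letter, which is accepted, or a
   push, which is not. *)
pose ones : seq (formula A K * option letter) :=
  [seq (And (Equal A Min Max) (Letter a Min),
        if `[< L [:: a] >] then None else Some (Push true)) | a <- enum A].
have [phis sz lE] :=
  @lindstrom_cases A the_groupoid _ letter_set bs b K (ones ++ fWord_cases H k0 d) None eG.
exists [set U : the_groupoid | Bal \in (U : {set nt})], bs, b, K, phis; split=> //.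
  by rewrite /K /word_width; lia.
move=> n w; rewrite /lindstrom lE.
pose g X := first_case [seq (sat w c.1 X, c.2) | c <- ones ++ fWord_cases H k0 d] None.
have lt0 : 0 < size (map g (lex_tuples n.+1 K)).
  rewrite size_map -(size_map val) -[map val _]/(lexs n.+1 K).
  by rewrite -(size_map (@lexval n.+1)) map_lexval size_iota expn_gt0.
have wpE := word_problem_Run lt0; rewrite -map_comp in wpE.
have fc (p : A -> bool) (f : A -> option letter) s r d' :
    first_case ([seq (p a, f a) | a <- s] ++ r) d' =
    if has p s then first_case [seq (p a, f a) | a <- s] d' else first_case r d'.
  by elim: s => //= a s ->; case: (p a).
case: n w lE @g lt0 wpE => [|n] w lE g lt0 wpE.
  pose a := tnth w ord0.
  have gE X : g X = if `[< L [:: a] >] then None else Some (Push true).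
    rewrite /g map_cat -map_comp (fc (fun a' => a == a')).
    have : a \in enum A by rewrite mem_enum.
    move=> aA; rewrite ifT; last by apply/hasP; exists a.
    move: aA.
    by elim: (enum A) => //= a' s IH; rewrite inE; case: eqP => [->|].
  have ew : tval w = [:: a] by case: w @a {lE g lt0 wpE gE} => -[|x []].
  have e1 : lex_tuples 1 K = [:: head (nseq_tuple K ord0) (lex_tuples 1 K)].
    by case: (lex_tuples 1 K) (size_lexs1 K) => [|? []].
  split=> [Lw|/wpE].
    apply/wpE; rewrite e1 /= gE asboolT -?ew //; constructor.
  rewrite e1 /= gE; case: asboolP => [|_ /Run_pushE/Run_nilE//].
  by rewrite ew.
have stripE : strip (map g (lex_tuples n.+2 K)) =
    pmap (word_letter d (node_width H k0) (node_rule H k0 w)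
      (fun X => has_tag X (htop H))) (lexs n.+2 K).
  rewrite /strip /lexs !pmap_map; apply: eq_pmap => X /=.
  (* In a longer word the table is inert, since its cases require the minimum to equal the
     maximum. *)
  rewrite /g map_cat -map_comp (fc (fun=> false)) has_pred0 /word_letter.
  by rewrite fWord_casesE.
have sw : size w = n.+2 by rewrite size_tuple.
have [tg fv] := root_node H k0 n.
split=> [/complete|/wpE].
  rewrite sw => /(_ isT)[m md pr]; apply/wpE; rewrite stripE.
  apply: (@dtree_Run _ _ _ _ _ m) => //.
    by apply: prf_dtree pr _ _ tg fv; rewrite size_nseq.
  by apply: contraNN (hroot_htop H) => h; apply/eqP; exact: has_tag_inj tg h.
rewrite stripE => /Run_dtree[m /dtree_prf]; rewrite size_nseq => /(_ erefl _ tg).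
by rewrite fv => pr; apply: (sound _ m); rewrite sw.
Qed.

(** * Binary normal form *)

Inductive cnf (C Q : Type) (bin : Q -> Q -> Q -> bool) (lett : Q -> C -> bool) :
    Q -> seq C -> Prop :=
| cnf_letter q c : lett q c -> cnf bin lett q [:: c]
| cnf_bin q q1 q2 y1 y2 : bin q q1 q2 ->
    cnf bin lett q1 y1 -> cnf bin lett q2 y2 -> cnf bin lett q (y1 ++ y2).

(** A semantic route to the normal form: no grammar is transformed. A family of languages in which
    every word of length at least 2 splits soundly into two nonempty parts already provides the
    rules. *)
Lemma cnf_of_languages (C Q : Type) (lang : Q -> seq C -> Prop) :
  (forall q y, 1 < size y -> lang q y -> exists q1 q2 y1 y2,
     [/\ y = y1 ++ y2, 0 < size y1 & 0 < size y2] /\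
     [/\ lang q1 y1, lang q2 y2 &
       forall u v, lang q1 u -> lang q2 v -> lang q (u ++ v)]) ->
  exists bin lett, forall q y, 0 < size y -> lang q y <-> cnf bin lett q y.
Proof.
move=> split_lang.
(* The rules are all those that are sound for the given languages. *)
exists (fun q q1 q2 => `[< forall u v, lang q1 u -> lang q2 v -> lang q (u ++ v) >]).
exists (fun q c => `[< lang q [:: c] >]) => q y y0; split; last first.
  by elim=> {q y y0} [q c /asboolP//|q q1 q2 y1 y2 /asboolP h _ h1 _ h2]; exact: h.
have [l] := ubnP (size y); elim: l q y y0 => // l IH q y y0 yl qy.
case: (ltnP 1 (size y)) => y1; last first.
  by case: y y0 y1 qy {yl} => [|c []] // _ _ qc; apply/cnf_letter/asboolP.
have [q1 [q2 [u [v [[e u0 v0] [qu qv h]]]]]] := split_lang q y y1 qy.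
move: yl; rewrite e size_cat ltnS => yl.
apply: (@cnf_bin _ _ _ _ q q1 q2); first exact/asboolP.
- by apply: IH => //; apply: leq_trans yl; rewrite -addn1 leq_add2l.
- by apply: IH => //; apply: leq_trans yl; rewrite -[(size v).+1]add1n leq_add2r.
Qed.

Section ParseTrees.

Variables (B : finType) (g : cfg B).
Local Notation sym := (nonterminal g + B)%type.

Inductive pt : seq sym -> seq B -> Prop :=
| pt_nil : pt [::] [::]
| pt_term b s y : pt s y -> pt (inr b :: s) (b :: y)
| pt_nt N r s y1 y2 :
    (N, r) \in rules g -> pt r y1 -> pt s y2 -> pt (inl N :: s) (y1 ++ y2).

Lemma pt_cat s s' y y' : pt s y -> pt s' y' -> pt (s ++ s') (y ++ y').
Proof.
move=> h h'; elim: h => {s y} //= [b s y _ IH|N r s y1 y2 Nr hr _ _ IH].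
  exact: pt_term.
by rewrite -catA; exact: pt_nt Nr hr IH.
Qed.

Lemma pt_catE s s' y : pt (s ++ s') y ->
  exists y1 y2, [/\ y = y1 ++ y2, pt s y1 & pt s' y2].
Proof.
move=> h; have [t et] : exists t, t = s ++ s' by eexists.
rewrite -et in h; elim: h s et => {t y} [|b t y h IH|N r t y1 y2 Nr hr _ h IH] [|x s] //=.
- by move=> <-; exists [::], [::]; split=> //; constructor.
- by move=> <-; exists [::], (b :: y); split=> //; constructor.
- by move=> [<- /IH[y1 [y2 [-> h1 h2]]]]; exists (b :: y1), y2; split=> //; constructor.
- by move=> <-; exists [::], (y1 ++ y2); split=> //; [constructor|exact: pt_nt hr h].
- move=> [<- /IH[z1 [z2 [-> h1 h2]]]]; exists (y1 ++ z1), z2.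
  by split=> //; [rewrite catA|exact: pt_nt hr h1].
Qed.

Lemma pt_map_inr y : pt (map inr y) y.
Proof. by elim: y => [|b y IH] /=; constructor. Qed.

Local Notation star := (clos_refl_trans _ (@derives1 B g)).

Lemma star_pt s t : star s t -> forall y, pt t y -> pt s y.
Proof.
elim=> {s t} // [s t [u v N r Nr] y|s t t' _ IH1 _ IH2 y /IH2/IH1 //].
move=> /pt_catE[y1 [y2 [-> h1 /pt_catE[y3 [y4 [-> h3 h4]]]]]].
by apply: pt_cat h1 _; exact: pt_nt Nr h3 h4.
Qed.

Lemma star_context u v s t : star s t -> star (u ++ s ++ v) (u ++ t ++ v).
Proof.
elim=> {s t} [s t [u' v' N r Nr]|s|s t t' _ IH1 _ IH2].
- apply: rt_step; rewrite -!catA /= !(catA u u').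
  exact: Derives1.
- exact: rt_refl.
- exact: rt_trans IH1 IH2.
Qed.

Lemma pt_star s y : pt s y -> star s (map inr y).
Proof.
elim=> {s y} [|b s y _ IH|N r s y1 y2 Nr _ IH1 _ IH2]; first exact: rt_refl.
  by have := star_context [:: inr b] [::] IH; rewrite /= !cats0.
apply: (rt_trans _ _ _ (r ++ s)); first by apply: rt_step; exact: (@Derives1 _ _ [::]).
rewrite map_cat; apply: (rt_trans _ _ _ (map inr y1 ++ s)).
  exact: (star_context [::] s IH1).
by have := star_context (map inr y1) [::] IH2; rewrite !cats0.
Qed.

Lemma generated_pt y : generated g y <-> pt [:: inl (start_symbol g)] y.
Proof. by split=> [/star_pt|/pt_star //]; apply; exact: pt_map_inr. Qed.

(** A finite stock of sentential forms, closed under the splittings of [pt_split]; each of them acts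
    as a nonterminal. *)
Definition items : seq (seq sym) :=
  [::] :: [seq [:: x] | x <- enum {: sym}] ++
  flatten [seq [seq drop i r.2 | i <- iota 0 (size r.2).+1] | r <- rules g].

Lemma item1 x : [:: x] \in items.
Proof. by rewrite inE mem_cat map_f ?orbT // mem_enum. Qed.

Lemma item_behead x s : x :: s \in items -> s \in items.
Proof.
rewrite inE mem_cat => /or3P[//|/mapP[x' _ [_ ->]]|]; first by rewrite mem_head.
move=> /flatten_mapP[r rg] /mapP[i]; rewrite mem_iota /= ltnS => ir e.
rewrite inE mem_cat; apply/or3P/Or33/flatten_mapP; exists r => //.
apply/mapP; exists i.+1; last by rewrite -add1n -drop_drop -e /= drop0.
rewrite mem_iota /= ltnS ltn_neqAle ir andbT; apply/negP => /eqP ei.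
by move: e; rewrite ei drop_size.
Qed.

Lemma item_rule N r : (N, r) \in rules g -> r \in items.
Proof.
move=> Nr; rewrite inE mem_cat; apply/or3P/Or33/flatten_mapP; exists (N, r) => //.
by apply/mapP; exists 0; rewrite ?drop0 // mem_iota.
Qed.

(** Erasing and unit rules disappear here: when the first symbol or the remaining ones derive the
    empty word, the split is inherited from the other part. *)
Lemma pt_split s y : pt s y -> s \in items -> 1 < size y ->
  exists s1 s2 y1 y2,
  [/\ y = y1 ++ y2, 0 < size y1 & 0 < size y2] /\
  [/\ s1 \in items, s2 \in items, pt s1 y1, pt s2 y2 &
    forall u v, pt s1 u -> pt s2 v -> pt s (u ++ v)].
Proof.
elim=> {s y} // [b s y h _|N r s y1 y2 Nr h1 IH1 h2 IH2] sI.
  rewrite ltnS => y0; exists [:: inr b], s, [:: b], y.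
  do 2 split=> //; first exact: item1; first exact: item_behead sI.
    by apply: pt_term; constructor.
  by move=> u v; exact: (@pt_cat [:: inr b]).
case: (posnP (size y1)) => [/size0nil e1|y10].
  rewrite e1 /= in h1 *; move=> y0.
  have [s1 [s2 [u [v [hy [i1 i2 p1 p2 h]]]]]] := IH2 (item_behead sI) y0.
  exists s1, s2, u, v; do 2 split=> //; move=> u' v' pu pv.
  by rewrite -[u' ++ v']cat0s; apply: pt_nt Nr h1 _; exact: h.
case: (posnP (size y2)) => [/size0nil e2|y20].
  rewrite e2 cats0 in h2 *; move=> y0.
  have [s1 [s2 [u [v [hy [i1 i2 p1 p2 h]]]]]] := IH1 (item_rule Nr) y0.
  exists s1, s2, u, v; do 2 split=> //; move=> u' v' pu pv.
  by rewrite -[u' ++ v']cats0; apply: pt_nt Nr _ h2; exact: h.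
move=> _; exists [:: inl N], s, y1, y2; do 2 split=> //; first exact: item1.
- exact: item_behead sI.
- by rewrite -[y1]cats0; apply: pt_nt Nr h1 _; constructor.
- by move=> u v; exact: (@pt_cat [:: inl N]).
Qed.

End ParseTrees.

(* The end marker [None] takes care of the empty word, which no binary normal form generates. *)
Lemma context_free_cnf (B : finType) (K : language B) : context_free K ->
  exists (Q : finType) (q0 : Q) (bin : Q -> Q -> Q -> bool) (lett : Q -> option B -> bool),
  forall y, K y <-> cnf bin lett q0 (rcons (map Some y) None).
Proof.
move=> [g gK]; pose I := 'I_(size (items g)); pose item (i : I) := nth [::] (items g) i.
have itemP s : s \in items g -> exists i : I, item i = s.
  move=> sI; have lt : index s (items g) < size (items g) by rewrite index_mem.
  by exists (Ordinal lt); rewrite /item nth_index.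
pose lang (q : option (option I)) (y' : seq (option B)) := match q with
  | None => y' = [:: None]
  | Some None => exists2 y, y' = rcons (map Some y) None & pt [:: inl (start_symbol g)] y
  | Some (Some i) => exists2 y, y' = map Some y & pt (item i) y
  end.
have [|bin [lett h]] := @cnf_of_languages (option B) (option (option I)) lang.
  move=> [[i|]|] y' /= y1 => [[y ey py]|[y ey py]|ey]; last by rewrite ey in y1.
    rewrite ey size_map in y1.
    have [s1 [s2 [u [v [[e u0 v0] [/itemP[i1 <-] /itemP[i2 <-] p1 p2 hs]]]]]] :=
      pt_split py (mem_nth _ (ltn_ord i)) y1.
    exists (Some (Some i1)), (Some (Some i2)), (map Some u), (map Some v).
    rewrite ey e map_cat !size_map; do 2 split=> //; [by exists u|by exists v|].
    by move=> _ _ [u' -> pu] [v' -> pv]; exists (u' ++ v'); [rewrite map_cat|exact: hs].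
  have [i ei] := itemP _ (item1 (inl (start_symbol g))).
  exists (Some (Some i)), None, (map Some y), [:: None].
  rewrite ey cats1; rewrite ey size_rcons ltnS in y1; do 2 split=> //.
    by exists y; rewrite ?ei.
  by move=> _ _ [u -> pu] ->; exists u; rewrite ?cats1 -?ei.
exists (option (option I)), (Some None), bin, lett => y.
rewrite -h ?size_rcons // /lang; split=> [/gK/generated_pt|[y' /rcons_inj[ey] py]]; first by exists y.
apply/gK/generated_pt.
by rewrite (inj_map (@Some_inj _) ey).
Qed.

(** * Transducers as path systems *)

Section TagType.

Variables (Q S O : finType) (b : nat).

(* A configuration is a state and a scanned symbol (type S) together with three numbers: the position
   of the input head and the contents of the work tape to the left and to the right of the head. The
   target [None] stands for the end of the computation. [TStep o s s'] is a step with output o, where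
   [None] is no output and [Some None] the end marker. [TMul r] with numbers x, y states y = b x + r,
   and [TTwo d e] is a conjunction of two such statements. *)
Inductive tm_tag :=
| TRoot | TTop
| TParse of Q & S & option S
| TStep of O & S & option S
| TTwo of 'I_b & 'I_b
| TMul of 'I_b.

Definition tm_tag_code (t : tm_tag) :
    bool + (Q * S * option S + (O * S * option S + ('I_b * 'I_b + 'I_b))) :=
  match t with
  | TRoot => inl true
  | TTop => inl false
  | TParse q s s' => inr (inl (q, s, s'))
  | TStep o s s' => inr (inr (inl (o, s, s')))
  | TTwo d e => inr (inr (inr (inl (d, e))))
  | TMul d => inr (inr (inr (inr d)))
  end.

Definition tm_tag_decode
    (x : bool + (Q * S * option S + (O * S * option S + ('I_b * 'I_b + 'I_b)))) :=
  match x with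
  | inl r => if r then TRoot else TTop
  | inr (inl (q, s, s')) => TParse q s s'
  | inr (inr (inl (o, s, s'))) => TStep o s s'
  | inr (inr (inr (inl (d, e)))) => TTwo d e
  | inr (inr (inr (inr d))) => TMul d
  end.

Lemma tm_tag_codeK : cancel tm_tag_code tm_tag_decode.
Proof. by case. Qed.

HB.instance Definition _ := Finite.copy tm_tag (can_type tm_tag_codeK).

End TagType.

Arguments TRoot {Q S O b}.
Arguments TTop {Q S O b}.
Arguments TParse {Q S O b}.
Arguments TStep {Q S O b}.
Arguments TTwo {Q S O b}.
Arguments TMul {Q S O b}.

Definition input_symbols (A : finType) : seq (input_symbol A) :=
  [:: LeftEnd, RightEnd & [seq Input a | a <- enum A]].

Lemma has_input_symbols (A : finType) U (P : pred U) (f : input_symbol A -> seq U) :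
  has P (flatten (map f (input_symbols A))) <-> exists a, has P (f a).
Proof.
have e : has P (flatten (map f (input_symbols A))) = has (fun a => has P (f a)) (input_symbols A).
  by elim: (input_symbols A) => //= a s <-; rewrite has_cat.
rewrite e /= has_map; split.
  by move=> /or3P[h|h|/hasP[a _ h]]; eexists; exact: h.
move=> [[||a] h]; apply/or3P; [exact: Or31|exact: Or32|apply: Or33].
by apply/hasP; exists a; rewrite ?mem_enum.
Qed.

(* Numbers 0 and 3 are the positions of the input head before and after the step. *)
Definition move_clause A (a : input_symbol A) (d : move) : seq (atom A) :=
  match d, a with
  | MoveLeft, LeftEnd => [:: Eq A 0 3]
  | MoveLeft, _ => [:: Succ A 3 0]
  | Stay, _ => [:: Eq A 0 3]
  | MoveRight, RightEnd => [:: Eq A 0 3]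
  | MoveRight, _ => [:: Succ A 0 3]
  end.

Lemma ReadsP (A : finType) (w : seq A) vals i a :
  reflect (read_input w (nth 0 vals i) = a) (atom_sem w vals (Reads i a)).
Proof.
rewrite /read_input; case: a => [||a] /=; case: (nth 0 vals i) => [|j] /=.
- by constructor.
- by constructor; case: onth.
- by constructor.
- by rewrite ltnS -onthNE; case: onth => [c|]; constructor.
- by constructor.
- by case: onth => [c|]; apply: (iffP eqP) => // -[->].
Qed.

(** Truncation of the head position takes effect only at the two end markers, so the symbol read
    tells whether the head really moves. *)
Lemma move_clauseP (A : finType) (w : seq A) vals a d :
  nth 0 vals 0 <= (size w).+1 -> read_input w (nth 0 vals 0) = a ->
  all (atom_sem w vals) (move_clause a d) =
  (nth 0 vals 3 == minn (shift d (nth 0 vals 0)) (size w).+1).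
Proof.
have rightE i : i <= (size w).+1 -> read_input w i = RightEnd -> i = (size w).+1.
  case: i => // i; rewrite ltnS /= => iw; case e : (onth w i) => [//|] _.
  by congr S; apply/eqP; rewrite eqn_leq iw -onthNE e.
have inputE i c : read_input w i = Input c -> 0 < i <= size w.
  by case: i => // i /=; rewrite -onthTE; case: onth.
have leftE i : read_input w i = LeftEnd -> i = 0.
  by case: i => // i /=; case: onth.
move=> iw e; case: d => /=.
- case: a e => [/leftE e0|/(rightE _ iw) e1|c /inputE/andP[i0 _]] /=; rewrite andbT.
  + by rewrite e0 min0n eq_sym.
  + by rewrite e1 /= (minn_idPl (leqnSn _)) eq_sym eqSS.
  + rewrite (minn_idPl _) ?(leq_trans (leq_pred _)) //.
    by rewrite -{1}(prednK i0) eqSS eq_sym.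
- by rewrite andbT (minn_idPl iw) eq_sym.
- case: a e => [/leftE e0|/(rightE _ iw) e1|c /inputE/andP[_ i1]] /=; rewrite andbT.
  + by rewrite e0 (minn_idPl _).
  + by rewrite e1 (minn_idPr _) ?leqnSn // eq_sym.
  + by rewrite (minn_idPl _).
Qed.

Section Digits.

Variables (G : finType) (bl : G).
Local Notation b := (#|G|.+1).

(* The digits on the left are positive, so that the number 0 means that the head is in cell 0. On the
   right the digit 0 is the blank, so that the infinitely many blanks make no contribution. *)
Definition digit_left (s : G) : 'I_b := lift ord0 (enum_rank s).
Definition digit_right (s : G) : 'I_b := if s == bl then ord0 else digit_left s.

Lemma digit_left_inj : injective digit_left.
Proof. by move=> s s' /lift_inj/enum_rank_inj. Qed.

Lemma digit_right_inj : injective digit_right.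
Proof.
move=> s s'; rewrite /digit_right; do 2 case: eqP => [->|_] //.
exact: digit_left_inj.
Qed.

(** The cell next to the head gives the least significant digit, so that a move of the work head
    amounts to one relation y = b x + r on each side. *)
Fixpoint num_left (tape : nat -> G) (p : nat) : nat :=
  if p is p'.+1 then b * num_left tape p' + digit_left (tape p') else 0.

Fixpoint num_right (tape : nat -> G) (p m : nat) : nat :=
  if m is m'.+1 then b * num_right tape p.+1 m' + digit_right (tape p) else 0.

Lemma num_left_lt tape p : num_left tape p < b ^ p.
Proof.
elim: p => //= p IH; rewrite expnS; have := ltn_ord (digit_left (tape p)).
set d := nat_of_ord _ => db; apply: (@leq_trans (b * (num_left tape p).+1)).
  by rewrite mulnS addnC ltn_add2r.
by rewrite leq_mul2l IH orbT.
Qed.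

Lemma num_right_lt tape p m : num_right tape p m < b ^ m.
Proof.
elim: m p => //= m IH p; rewrite expnS; have := ltn_ord (digit_right (tape p)).
set d := nat_of_ord _ => db; apply: (@leq_trans (b * (num_right tape p.+1 m).+1)).
  by rewrite mulnS addnC ltn_add2r.
by rewrite leq_mul2l IH orbT.
Qed.

Lemma eq_num_left tape tape' p : (forall i, i < p -> tape i = tape' i) ->
  num_left tape p = num_left tape' p.
Proof.
elim: p => //= p IH e; rewrite e // IH // => i ip; apply: e; exact: ltnW.
Qed.

Lemma eq_num_right tape tape' p m : (forall i, p <= i -> tape i = tape' i) ->
  num_right tape p m = num_right tape' p m.
Proof.
elim: m p => //= m IH p e; rewrite e // IH // => i ip; apply: e; exact: ltnW.
Qed.

Lemma num_right_blank p m : num_right (fun=> bl) p m = 0.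
Proof. by elim: m p => //= m IH p; rewrite IH /digit_right eqxx muln0. Qed.

Lemma digits_inj (x y : nat) (d e : 'I_b) : b * x + d = b * y + e -> x = y /\ d = e.
Proof.
move=> h; have h1 : x = y.
  have := congr1 (divn^~ b) h.
  by rewrite !(mulnC b) !divnMDl // !divn_small ?ltn_ord // !addn0.
by split=> //; apply: val_inj; move: h; rewrite h1 => /addnI.
Qed.

End Digits.

Arguments run : simpl never.

Lemma cnf_gt0 C Q bin lett q (y : seq C) : @cnf C Q bin lett q y -> 0 < size y.
Proof. by elim=> //= *; rewrite size_cat addn_gt0; apply/orP; left. Qed.

(** * Clauses for a transducer, their soundness and completeness *)

Section Machine.

Variables (A B : finType) (M : transducer A B).
Variables (Q : finType) (q0 : Q) (bin : Q -> Q -> Q -> bool) (lett : Q -> option B -> bool).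

Local Notation G := (work_symbol M).
Local Notation b := (#|G|.+1).
Local Notation st := (state M * work_symbol M)%type.
Local Notation T := (tm_tag Q (state M * work_symbol M)%type (option (option B)) b).
Local Notation dl := (@digit_left G).
Local Notation dr := (@digit_right G (blank M)).

(** These steps keep both tape numbers. A left move in cell 0 is among them, recognized by the left
    number 0. *)
Definition stay_clause (r1 : G) o (p1 : state M) (a : input_symbol A)
    (tr : option (state M * G * move * move * option B)) : seq (seq (atom A)) :=
  if tr is Some (p', s, di, dw, o') then
    if [&& p' == p1, r1 == s & o == omap Some o'] then
      match dw with
      | MoveLeft => [:: [:: Reads 0 a, Zero A 1, Eq A 1 4, Eq A 2 5 & move_clause a di]]
      | Stay => [:: [:: Reads 0 a, Eq A 1 4, Eq A 2 5 & move_clause a di]]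
      | MoveRight => [::]
      end
    else [::]
  else [::].

(** Indices 0 to 2 and 3 to 5 are the configurations before and after, 6 to 9 the numbers of the
    premise [TTwo]. The written symbol becomes a digit on the side left behind, the newly scanned
    one is removed from the other side. *)
Definition shift_clause (r1 : G) o (p1 : state M) (d e : 'I_b) (a : input_symbol A)
    (tr : option (state M * G * move * move * option B)) : seq (seq (atom A)) :=
  if tr is Some (p', s, di, dw, o') then
    if (p' == p1) && (o == omap Some o') then
      match dw with
      | MoveLeft => if (d == dl r1) && (e == dr s) then
          [:: [:: Reads 0 a, Eq A 4 6, Eq A 1 7, Eq A 2 8, Eq A 5 9 & move_clause a di]]
          else [::]
      | Stay => [::]
      | MoveRight => if (d == dl s) && (e == dr r1) then
          [:: [:: Reads 0 a, Eq A 1 6, Eq A 4 7, Eq A 5 8, Eq A 2 9 & move_clause a di]]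
          else [::]
      end
    else [::]
  else [::].

Definition chain_clause : seq (atom A) :=
  [:: Eq A 0 6; Eq A 1 7; Eq A 2 8; Eq A 9 12; Eq A 10 13; Eq A 11 14;
      Eq A 3 15; Eq A 4 16; Eq A 5 17].

(** Silent steps are attached in front of a parse, so that a parse ends right after an output;
    halting counts as a step that outputs the end marker. *)
Definition tm_clauses (tA tB tC : T) : seq (seq (atom A)) :=
  match tA, tB, tC with
  | TRoot, TParse q s s', TTop =>
      if [&& q == q0, s == (init_state M, blank M) & s' == None] then
        [:: [seq Zero A i | i <- iota 6 6]] else [::]
  | TParse q s s', TParse q1 t t', TParse q2 u u' =>
      if [&& bin q q1 q2, t == s, t' == Some u & u' == s'] then [:: chain_clause] else [::]
  | TParse q s s', TStep o t t', TParse q2 u u' =>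
      if [&& o == None, q2 == q, t == s, t' == Some u & u' == s'] then [:: chain_clause] else [::]
  | TParse q s s', TStep (Some c) t t', TTop =>
      if [&& lett q c, t == s & t' == s'] then
        [:: [seq Eq A i (6 + i) | i <- iota 0 6]] else [::]
  | TStep o s None, TTop, TTop =>
      if o == Some None then flatten [seq
        if delta s.1 a s.2 is None then [:: [:: Reads 0 a; Zero A 3; Zero A 4; Zero A 5]] else [::]
      | a <- input_symbols A] else [::]
  | TStep o s (Some s1), TTop, TTop =>
      flatten [seq stay_clause s1.2 o s1.1 a (delta s.1 a s.2) | a <- input_symbols A]
  | TStep o s (Some s1), TTwo d e, TTop =>
      flatten [seq shift_clause s1.2 o s1.1 d e a (delta s.1 a s.2) | a <- input_symbols A]
  | TTwo d e, TMul d', TMul e' =>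
      if (d' == d) && (e' == e) then
        [:: [:: Eq A 0 6; Eq A 1 7; Eq A 2 12; Eq A 3 13]] else [::]
  | TMul r, TTop, TTop => if r == ord0 then [:: [:: Zero A 0; Zero A 1]] else [::]
  | TMul r, TMul r', TTop =>
      (if r == r'.+1 :> nat then [:: [:: Eq A 0 6; Succ A 7 1]] else [::]) ++
      (if (r == ord0) && (r' == ord_max) then [:: [:: Succ A 6 0; Succ A 7 1]] else [::])
  | _, _, _ => [::]
  end.

Definition tm_horn : horn A :=
  @Horn A T TRoot TTop (isT : TRoot != TTop :> T) tm_clauses.

Variables (w : seq A) (N Sb t_end : nat).
Local Notation conf := (run M w).
Hypothesis work_bound : forall t, work_pos (conf t) <= Sb.
Hypothesis halted : transition w (conf t_end) = None.
Hypothesis running : forall t, t < t_end -> transition w (conf t) <> None.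
Hypothesis N_input : (size w).+1 < N.
Hypothesis N_work : b ^ Sb <= N.

(** The time t_end + 1 is fictitious and represents the end of the computation; the step leading to
    it emits the end marker. *)
Definition key_state t : option st :=
  if t <= t_end then
    Some (cstate (conf t), work_tape (conf t) (work_pos (conf t))) else None.

Definition key_fields t : seq nat :=
  if t <= t_end then
    [:: input_pos (conf t);
        num_left (work_tape (conf t)) (work_pos (conf t));
        num_right (blank M) (work_tape (conf t)) (work_pos (conf t)).+1
          (Sb - work_pos (conf t))]
  else [:: 0; 0; 0].

Definition out t : option (option B) :=
  if t < t_end then
    if transition w (conf t) is Some (_, _, _, _, o) then omap Some o else None
  else Some None.

Lemma input_pos_le t : input_pos (conf t) <= (size w).+1.
Proof.
elim: t => // t IH; rewrite /run iterS -/(conf t) /step.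
by case: transition => // -[[[[q s] di] dw] o] /=; exact: geq_minr.
Qed.

Lemma runS t q s di dw o : transition w (conf t) = Some (q, s, di, dw, o) ->
  conf t.+1 = {| cstate := q;
       input_pos := minn (shift di (input_pos (conf t))) (size w).+1;
       work_pos := shift dw (work_pos (conf t));
       work_tape := fun i => if i == work_pos (conf t) then s else work_tape (conf t) i;
       output := if o is Some x then rcons (output (conf t)) x else output (conf t) |}.
Proof. by move=> e; rewrite /run iterS -/(conf t) /step e. Qed.

Lemma pmap_out t : t <= t_end -> pmap out (iota 0 t) = map Some (output (conf t)).
Proof.
elim: t => // t IH lt.
case e : (transition w (conf t)) (running lt) => [[[[[q s] di] dw] o]|] // _.
rewrite (runS e) -addn1 iotaD pmap_cat (IH (ltnW lt)) /= add0n /out lt e.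
by case: o {e} => [c|] /=; rewrite ?cats0 // map_rcons cats1.
Qed.

Lemma pmap_out_end : pmap out (iota 0 t_end.+1) = rcons (map Some (output (conf t_end))) None.
Proof. by rewrite -addn1 iotaD pmap_cat pmap_out //= /out ltnn cats1. Qed.

Lemma key_fields_lt t : all (fun x => x < N) (key_fields t).
Proof.
rewrite /key_fields; case: leqP => _ /=; last by rewrite !(leq_ltn_trans _ N_input).
rewrite (leq_ltn_trans (input_pos_le t)) //= andbT; apply/andP; split.
  apply: leq_trans (num_left_lt _ _) (leq_trans _ N_work).
  by rewrite leq_pexp2l.
apply: leq_trans (num_right_lt _ _ _ _) (leq_trans _ N_work).
by rewrite leq_pexp2l // leq_subr.
Qed.

Lemma size_key_fields t : size (key_fields t) = 3.
Proof. by rewrite /key_fields; case: ifP. Qed.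

Lemma key_transition t s a : t <= t_end -> key_state t = Some s ->
  read_input w (nth 0 (key_fields t) 0) = a ->
  transition w (conf t) = delta s.1 a s.2.
Proof. by rewrite /key_state /key_fields => -> [<-] <-. Qed.

(** For a left move the first alternative is the work head blocked in cell 0. *)
Lemma key_next t i l r p s di dw o : t < t_end ->
  transition w (conf t) = Some (p, s, di, dw, o) -> key_fields t = [:: i; l; r] ->
  exists r1 l' r',
    [/\ key_state t.+1 = Some (p, r1),
        key_fields t.+1 = [:: minn (shift di i) (size w).+1; l'; r'],
        out t = omap Some o &
        match dw with
        | Stay => [/\ r1 = s, l' = l & r' = r]
        | MoveLeft => [/\ l = 0, r1 = s, l' = l & r' = r] \/
                      l = b * l' + dl r1 /\ r' = b * r + dr s
        | MoveRight => l' = b * l + dl s /\ r = b * r' + dr r1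
        end].
Proof.
move=> lt e; rewrite /key_fields (ltnW lt) => -[<- <- <-].
have := work_bound t; have := work_bound t.+1.
rewrite /key_state /key_fields /out lt e (runS e) /=.
set pos := work_pos (conf t) => pS pT; set tape := work_tape (conf t).
have agree_left q : num_left (fun i => if i == pos then s else tape i) (minn q pos) = num_left tape (minn q pos).
  by apply: eq_num_left => j; rewrite leq_min => /andP[_ jp]; rewrite ltn_eqF.
have agree_right q m : pos < q ->
    num_right (blank M) (fun i => if i == pos then s else tape i) q m =
    num_right (blank M) tape q m.
  move=> pq; apply: eq_num_right => j qj; rewrite gtn_eqF //.
  exact: leq_trans qj.
have al : num_left (fun i => if i == pos then s else tape i) pos = num_left tape pos.
  by have := agree_left pos; rewrite minnn.
do 3 eexists; split; [reflexivity|reflexivity|by []|].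
case: dw e pS => /= e pS.
- case: pos pT agree_left agree_right pS al => [|pos] pT agree_left agree_right pS al.
    by left; split=> //=; rewrite agree_right.
  right; have := agree_left pos; rewrite (minn_idPl (leqnSn pos)) /= => ->.
  rewrite (ltn_eqF (ltnSn pos)); split=> //.
  (* By the space bound the range of cells on the right is nonempty, so one digit can be split
     off. *)
  by rewrite -[Sb - pos]prednK ?subn_gt0 // -subnS /= eqxx agree_right.
- by rewrite eqxx al agree_right.
- rewrite eqxx al (gtn_eqF (ltnSn pos)); split=> //.
  by rewrite -[Sb - pos]prednK ?subn_gt0 // -subnS /= agree_right.
Qed.

(** The first configuration is tied to a time of the actual run. For nodes about configurations that
    do not occur nothing is claimed, and since the machine is deterministic the second configuration
    is found further along the same run. *)
Definition meaning (t : T) (a : seq nat) : Prop :=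
  match t with
  | TRoot => cnf bin lett q0 (pmap out (iota 0 t_end.+1))
  | TTop => True
  | TParse q s s' => forall t, t <= t_end -> key_state t = Some s ->
      key_fields t = take 3 a -> exists t',
      [/\ t < t' <= t_end.+1, key_state t' = s', key_fields t' = drop 3 a &
          cnf bin lett q (pmap out (iota t (t' - t)))]
  | TStep o s s' => forall t, t <= t_end -> key_state t = Some s ->
      key_fields t = take 3 a ->
      [/\ key_state t.+1 = s', key_fields t.+1 = drop 3 a & out t = o]
  | TTwo d e => nth 0 a 1 = b * nth 0 a 0 + d /\ nth 0 a 3 = b * nth 0 a 2 + e
  | TMul d => nth 0 a 1 = b * nth 0 a 0 + d
  end.

Lemma key_state_end : key_state t_end.+1 = None.
Proof. by rewrite /key_state ltnn. Qed.

Lemma key_fields_end : key_fields t_end.+1 = [:: 0; 0; 0].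
Proof. by rewrite /key_fields ltnn. Qed.

Lemma key_state_le t s : t <= t_end.+1 -> key_state t = Some s -> t <= t_end.
Proof. by rewrite /key_state; case: (leqP t t_end). Qed.

Lemma transition_lt t : t <= t_end -> transition w (conf t) <> None -> t < t_end.
Proof.
by rewrite leq_eqVlt => /predU1P[->|//]; rewrite halted.
Qed.

Lemma read_key_lt t : t <= t_end -> nth 0 (key_fields t) 0 <= (size w).+1.
Proof. by rewrite /key_fields => -> /=; exact: input_pos_le. Qed.

Lemma fields6 a : is_fields N a -> exists a0 a1 a2 a3 a4 a5, a = [:: a0; a1; a2; a3; a4; a5].
Proof.
case: a => [|a0 [|a1 [|a2 [|a3 [|a4 [|a5 [|a6 a]]]]]]] //; rewrite /is_fields /= ?andbF //.
by do 6 eexists.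
Qed.

Lemma cnf_iota q q1 q2 t t1 t2 : t < t1 < t2 -> bin q q1 q2 ->
  cnf bin lett q1 (pmap out (iota t (t1 - t))) ->
  cnf bin lett q2 (pmap out (iota t1 (t2 - t1))) ->
  cnf bin lett q (pmap out (iota t (t2 - t))).
Proof.
move=> /andP[tt1 t12] bq h1 h2.
have -> : t2 - t = (t1 - t) + (t2 - t1) by lia.
rewrite iotaD pmap_cat subnKC; last exact: ltnW.
exact: cnf_bin bq h1 h2.
Qed.

Lemma key_next_move vals t s i l r x p s0 di dw o :
  t <= t_end -> key_state t = Some s -> key_fields t = [:: i; l; r] ->
  nth 0 vals 0 = i -> read_input w (nth 0 vals 0) = x ->
  delta s.1 x s.2 = Some (p, s0, di, dw, o) ->
  t < t_end /\ exists r1 l' r',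
    [/\ key_state t.+1 = Some (p, r1),
        key_fields t.+1 = [:: minn (shift di i) (size w).+1; l'; r'],
        out t = omap Some o,
        all (atom_sem w vals) (move_clause x di) =
          (nth 0 vals 3 == minn (shift di i) (size w).+1) &
        match dw with
        | Stay => [/\ r1 = s0, l' = l & r' = r]
        | MoveLeft => [/\ l = 0, r1 = s0, l' = l & r' = r] \/
                      l = b * l' + dl r1 /\ r' = b * r + dr s0
        | MoveRight => l' = b * l + dl s0 /\ r = b * r' + dr r1
        end].
Proof.
move=> tle ks kf vi rd e.
have tr : transition w (conf t) = Some (p, s0, di, dw, o).
  by rewrite (key_transition tle ks (a := x)) // kf /= -vi.
have lt : t < t_end by apply: transition_lt; rewrite ?tr.
split=> //; have [r1 [l' [r' [h1 h2 h3 h4]]]] := key_next lt tr kf.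
exists r1, l', r'; split=> //; rewrite move_clauseP // vi //.
by have := read_key_lt tle; rewrite kf.
Qed.

Lemma prf_meaning t a m : prf (H := tm_horn) w N t a m -> meaning t a.
Proof.
elim=> {t a m} // tA tB tC a b' c m1 m2 [/fields6[a0 [a1 [a2 [a3 [a4 [a5 ->]]]]]]
  /fields6[b0 [b1 [b2 [b3 [b4 [b5 ->]]]]]] /fields6[c0 [c1 [c2 [c3 [c4 [c5 ->]]]]]]].
rewrite [clauses _ _ _]/= => h _ IHB _ IHC; move: h IHB IHC.
case: tA => [||q s s'|o s [s1|]|d e|r]; case: tB => [||q1 t t'|o1 t t'|d1 e1|r1];
  case: tC => [||q2 u u'|o2 u u'|d2 e2|r2] //; try by case: o1.
- rewrite /tm_clauses; case: ifP => // /and3P[/eqP-> /eqP-> /eqP->] /=.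
  rewrite andbT orbF => /and5P[/eqP-> /eqP-> /eqP-> _ _] h _.
  have [//|||t1 [/andP[t10 t1e] ks _]] := h 0.
  + by rewrite /key_state leq0n.
  + by rewrite /key_fields leq0n /= num_right_blank.
  (* Only the fictitious time has no state, so the parse from time 0 covers the whole output. *)
  + suff -> : t1 = t_end.+1 by rewrite subn0.
    apply/eqP; rewrite eqn_leq t1e ltnNge; apply/negP => le.
    by move: ks; rewrite /key_state le.
- rewrite /tm_clauses; case: ifP => // /and4P[bq /eqP-> /eqP-> /eqP->] /=.
  rewrite !andbT orbF => /and5P[/eqP-> /eqP-> /eqP-> /eqP e3 /and5P[/eqP e4 /eqP e5 /eqP-> /eqP-> /eqP->]].
  move=> h1 h2 t0 tle ks kf.
  have [t1 [/andP[t01 t1e] ks1 kf1 cn1]] := h1 t0 tle ks kf.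
  have [|t2 [/andP[t12 t2e] ks2 kf2 cn2]] := h2 t1 (key_state_le t1e ks1) ks1.
    by rewrite kf1 e3 e4 e5.
  exists t2; split=> //; first by rewrite (ltn_trans t01 t12).
  by apply: cnf_iota bq cn1 cn2; rewrite t01.
- rewrite /tm_clauses; case: o1 => // o1; case: ifP => // /and3P[lq /eqP-> /eqP->] /=.
  rewrite !andbT orbF => /and5P[/eqP-> /eqP-> /eqP-> /eqP-> /andP[/eqP-> /eqP->]].
  move=> h _ t0 tle ks kf; have [ks1 kf1 eo] := h t0 tle ks kf.
  exists t0.+1; split=> //; first by rewrite ltnSn ltnS.
  by rewrite subSnn /= eo; exact: cnf_letter.
- rewrite /tm_clauses; case: o1 => [o1|] //.
  case: ifP => // /and5P[_ /eqP-> /eqP-> /eqP-> /eqP->] /=.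
  rewrite !andbT orbF => /and5P[/eqP-> /eqP-> /eqP-> /eqP e3 /and5P[/eqP e4 /eqP e5 /eqP-> /eqP-> /eqP->]].
  move=> h1 h2 t0 tle ks kf; have [ks1 kf1 eo] := h1 t0 tle ks kf.
  have [||t2 [/andP[t12 t2e] ks2 kf2 cn2]] := h2 t0.+1 _ ks1.
  + exact: key_state_le ks1.
  + by rewrite kf1 e3 e4 e5.
  exists t2; split=> //; first by rewrite (ltn_trans _ t12).
  by rewrite (_ : t2 - t0 = (t2 - t0.+1).+1) /= ?eo //; lia.
- rewrite /tm_clauses => /has_input_symbols[x h] _ _ t0 tle ks kf.
  move: h; rewrite /stay_clause.
  case e : delta => [[[[[p' s0] di] dw] o']|] //; case: ifP => // /and3P[/eqP ep /eqP er /eqP eo].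
  set vals := (_ ++ _) => h.
  have rd : read_input w (nth 0 vals 0) = x.
    by apply/ReadsP; case: dw e h => // e /orP[] // /andP[].
  have [lt [r1 [l' [r' [ks1 kf1 o1 mv h']]]]] :=
    key_next_move tle ks kf (erefl : nth 0 vals 0 = a0) rd e.
  have : [/\ r1 = s0, l' = a4, r' = a5 & a3 = minn (shift di a0) (size w).+1].
    case: dw e h h' => // e; cbn [has all]; rewrite orbF mv.
      move=> /and5P[_ /eqP/= z /eqP/= <- /eqP/= <- /eqP/= ->] [[_ -> -> ->] //|[z' _]].
      by move: z' => /esym/eqP; rewrite z addn_eq0 andbF.
    by move=> /and4P[_ /eqP/= <- /eqP/= <- /eqP/= ->] [-> -> ->].
  move=> [e1 e2 e3 e4]; rewrite ks1 kf1 o1 e1 e2 e3 -e4 eo; split=> //.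
  by rewrite ep -er; case: (s1).
- rewrite /tm_clauses => /has_input_symbols[x h] /= [hb1 hb3] _ t0 tle ks kf.
  move: h; rewrite /shift_clause.
  case e : delta => [[[[[p' s0] di] dw] o']|] //; case: ifP => // /andP[/eqP ep /eqP eo].
  set vals := (_ ++ _) => h.
  have rd : read_input w (nth 0 vals 0) = x.
    by apply/ReadsP; case: dw e h => // e; case: ifP => // _ /orP[] // /andP[].
  have [lt [r' [l' [rr [ks1 kf1 o1 mv h']]]]] :=
    key_next_move tle ks kf (erefl : nth 0 vals 0 = a0) rd e.
  have : [/\ r' = s1.2, l' = a4, rr = a5 & a3 = minn (shift di a0) (size w).+1].
    case: dw e h h' => // e; case: ifP => // /andP[/eqP ed /eqP ee];
      cbn [has all]; rewrite orbF mv.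
      move=> /and5P[_ /eqP/= f4 /eqP/= f1 /eqP/= f2 /andP[/eqP/= f5 /eqP/= ->]].
      rewrite f1 hb1 ed f4 f5 hb3 ee f2; move=> [[/eqP]|[]].
        (* A left digit is positive, so the left number is not 0 and the head is not in cell 0. *)
        by rewrite addn_eq0 andbF.
      by move=> /(@digits_inj _ _ _ (dl s1.2) (dl r'))[-> /digit_left_inj ->] ->.
    move=> /and5P[_ /eqP/= f1 /eqP/= f4 /eqP/= f5 /andP[/eqP/= f2 /eqP/= ->]].
    rewrite f4 hb1 f1 ed f2 hb3 f5 ee => -[-> ].
    by move=> /(@digits_inj _ _ _ (dr s1.2) (dr r'))[-> /digit_right_inj ->].
  move=> [h1 h2 h3 h4]; rewrite ks1 kf1 o1 h1 h2 h3 -h4 eo; split=> //.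
  by rewrite ep; case: (s1).
- rewrite /tm_clauses; case: ifP => // /eqP-> /has_input_symbols[x h] _ _ t0 tle ks kf.
  move: h; case e : delta => [//|]; set vals := (_ ++ _); cbn [has all].
  rewrite orbF andbT => /and4P[/ReadsP rd /eqP/= -> /eqP/= -> /eqP/= ->].
  have tr : transition w (conf t0) = None.
    by rewrite (key_transition tle ks (a := x)) // kf.
  have et : t0 = t_end.
    by apply/eqP; rewrite eqn_leq tle leqNgt; apply/negP => /running; rewrite tr.
  by rewrite et key_state_end key_fields_end /out ltnn.
- rewrite /tm_clauses; case: ifP => // /andP[/eqP-> /eqP->] /=.
  by rewrite andbT orbF => /and4P[/eqP-> /eqP-> /eqP-> /eqP->] -> ->.
- rewrite /tm_clauses; case: ifP => // /eqP-> /=.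
  by rewrite andbT orbF => /andP[/eqP-> /eqP->] _ _; rewrite muln0.
- rewrite /tm_clauses has_cat => /orP[].
    case: ifP => // /eqP er /=; rewrite andbT orbF => /andP[/eqP-> /eqP->] -> _.
    by rewrite er addnS.
  case: ifP => // /andP[/eqP-> /eqP->] /=; rewrite andbT orbF => /andP[/eqP-> /eqP->] -> _.
  by rewrite addn0 -addnS mulnS addnC.
Qed.

Notation prv := (prf (H := tm_horn) w N).

Lemma N_gt0 : 0 < N.
Proof. exact: leq_ltn_trans N_input. Qed.

(** Induction on y: the remainder decreases by one or, at 0, wraps to b - 1 while x decreases. This
    takes one rule for each of the values y, ..., 0. *)
Lemma prf_mul (d : 'I_b) x y : y = b * x + d -> y < N ->
  prv (TMul d) [:: x; y; 0; 0; 0; 0] y.+1.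
Proof.
have N0 := N_gt0.
have z : is_fields N [:: 0; 0; 0; 0; 0; 0] by rewrite /is_fields /= N0.
elim: y d x => [|y IH] d x e yN.
  move/esym/eqP: (e); rewrite addn_eq0 muln_eq0 /= => /andP[/eqP-> d0].
  apply: (@prf_rule _ tm_horn w N (TMul d) TTop TTop _ _ _ 0 0 _ _
    (prf_top tm_horn w z) (prf_top tm_horn w z)); first by split.
  by rewrite /= (_ : d == ord0) //; apply/eqP/val_inj/eqP.
have xy : x <= y.+1 by rewrite e (leq_trans (leq_pmull x (ltn0Sn #|G|))) ?leq_addr.
have xN : x < N := leq_ltn_trans xy yN.
have fa : is_fields N [:: x; y.+1; 0; 0; 0; 0] by rewrite /is_fields /= xN yN N0.
rewrite -[y.+2]addn0 addSn.
case: (posnP d) => [d0|d1].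
  have {}d0 : d = ord0 by apply: val_inj.
  case: x e xy xN fa => [|x] e xy xN fa; first by move: e; rewrite d0 muln0.
  have ex : y = b * x + (ord_max : 'I_b).
    by move: e; rewrite d0 mulnS /=; lia.
  have fb : is_fields N [:: x; y; 0; 0; 0; 0].
    by rewrite /is_fields /= (ltnW xN) (ltnW yN) N0.
  apply: (prf_rule _ _ (IH ord_max x ex (ltnW yN)) (prf_top tm_horn w z)); first by split.
  by rewrite /= d0 /= ?eqxx /= ?eqxx.
have dlt : d.-1 < b by apply: leq_ltn_trans (leq_pred _) (ltn_ord d).
have ex : y = b * x + Ordinal dlt by apply: succn_inj; rewrite e /= -addnS prednK.
have fb : is_fields N [:: x; y; 0; 0; 0; 0].
  by rewrite /is_fields /= xN (ltnW yN) N0.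
apply: (prf_rule _ _ (IH _ x ex (ltnW yN)) (prf_top tm_horn w z)); first by split.
by rewrite /= has_cat prednK // eqxx /= !eqxx.
Qed.

Lemma prf_two (d e : 'I_b) x y x' y' : y = b * x + d -> y' = b * x' + e ->
  y < N -> y' < N -> prv (TTwo d e) [:: x; y; x'; y'; 0; 0] (y.+1 + y'.+1).+1.
Proof.
move=> ey ey' yN y'N.
have le u v (f : 'I_b) : v = b * u + f -> v < N -> u < N.
  move=> ev; apply: leq_ltn_trans; rewrite ev (leq_trans (leq_pmull u (ltn0Sn #|G|))) ?leq_addr //.
have N0 := N_gt0; have xN := le _ _ _ ey yN; have x'N := le _ _ _ ey' y'N.
apply: (prf_rule _ _ (prf_mul ey yN) (prf_mul ey' y'N)).
  by split; rewrite /is_fields /= ?xN ?x'N ?yN ?y'N N0.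
by rewrite /= !eqxx /= !eqxx.
Qed.

Lemma is_fields_cat u v : size u = 3 -> size v = 3 ->
  all (fun x => x < N) u -> all (fun x => x < N) v -> is_fields N (u ++ v).
Proof. by move=> su sv hu hv; rewrite /is_fields size_cat su sv all_cat hu hv. Qed.

Lemma is_fields_key t t' : is_fields N (key_fields t ++ key_fields t').
Proof. by apply: is_fields_cat; rewrite ?size_key_fields ?key_fields_lt. Qed.

(** The bound is the cost of a shift: two countings with at most N rules each, one rule for [TTwo]
    and one for the step. *)
Lemma prf_step t s : t <= t_end -> key_state t = Some s ->
  exists2 m, m <= 2 * N + 2 &
    prv (TStep (out t) s (key_state t.+1)) (key_fields t ++ key_fields t.+1) m.
Proof.
move=> tle ks; have fa := is_fields_key t t.+1; have N0 := N_gt0.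
have z : is_fields N [:: 0; 0; 0; 0; 0; 0] by rewrite /is_fields /= N0.
have top := prf_top tm_horn w z.
set x := read_input w (nth 0 (key_fields t) 0).
have tr : transition w (conf t) = delta s.1 x s.2 by apply: key_transition tle ks _.
case: (ltnP t t_end) => [lt|ge]; last first.
  have et : t = t_end by apply/eqP; rewrite eqn_leq tle.
  rewrite et key_state_end key_fields_end /out ltnn.
  exists 1; first lia.
  apply: (prf_rule _ _ top top); first by split=> //; rewrite -key_fields_end -et.
  rewrite /= ?eqxx; apply/has_input_symbols; exists x.
  rewrite -tr et halted /= orbF andbT; apply/and4P; split.
    by apply/(ReadsP w _ 0 x); rewrite /x et /key_fields leqnn.
  by rewrite /key_fields leqnn. by rewrite /key_fields leqnn. by rewrite /key_fields leqnn.
have [i [l [r kf]]] : exists i l r, key_fields t = [:: i; l; r].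
  by case: (key_fields t) (size_key_fields t) => [|i [|l [|r []]]] // _; exists i, l, r.
move: tr; case e : (transition w (conf t)) (running lt) => [[[[[p s0] di] dw] o]|] // _ tr.
have [r1 [l' [r' [ks1 kf1 eo h]]]] := key_next lt e kf.
have := key_fields_lt t.+1; rewrite kf1 => /and4P[_ l'N r'N _].
have := key_fields_lt t; rewrite kf => /and4P[_ lN rN _].
have mv vals : nth 0 vals 0 = i -> nth 0 vals 3 = minn (shift di i) (size w).+1 ->
    all (atom_sem w vals) (move_clause x di).
  have iw : i <= (size w).+1 by have := read_key_lt tle; rewrite kf.
  have ix : read_input w i = x by rewrite /x kf.
  by move=> v0 v3; rewrite move_clauseP ?v0 ?v3.
have rd vals : nth 0 vals 0 = i -> atom_sem w vals (Reads 0 x).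
  by move=> v0; apply/ReadsP; rewrite v0 /x kf.
rewrite kf kf1 in fa *; rewrite ks1 eo.
have two (d d' : 'I_b) x1 y1 x2 y2 : y1 = b * x1 + d -> y2 = b * x2 + d' -> y1 < N -> y2 < N ->
    let b' := [:: x1; y1; x2; y2; 0; 0] in
    is_fields N b' /\ exists2 m, m <= 2 * N + 1 & prv (TTwo d d') b' m.
  move=> e1 e2 y1N y2N b'; split; last first.
    by exists (y1.+1 + y2.+1).+1; [lia|exact: prf_two].
  have le u v (f : 'I_b) : v = b * u + f -> v < N -> u < N.
    move=> ev; apply: leq_ltn_trans; rewrite ev (leq_trans (leq_pmull u (ltn0Sn #|G|))) ?leq_addr //.
  by rewrite /is_fields /= y1N y2N (le _ _ _ e1 y1N) (le _ _ _ e2 y2N) N0.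
case: dw e tr h => e tr.
- move=> [[l0 er1 el' er']|[el er]].
    exists 1; first lia.
    apply: (prf_rule _ _ top top); first by split.
    rewrite /=; apply/has_input_symbols; exists x; rewrite -tr /stay_clause er1 !eqxx.
    by cbn [has all andb]; rewrite rd //= mv //= el' er' l0 !eqxx.
  have [fb [m mN pm]] := two _ _ _ _ _ _ el er lN r'N.
  exists (m + 0).+1; first lia.
  apply: (prf_rule _ _ pm top); first by split.
  rewrite /=; apply/has_input_symbols; exists x; rewrite -tr /shift_clause !eqxx.
  by cbn [has all andb]; rewrite rd //= mv //= !eqxx.
- move=> [er1 el' er']; exists 1; first lia.
  apply: (prf_rule _ _ top top); first by split.
  rewrite /=; apply/has_input_symbols; exists x; rewrite -tr /stay_clause er1 !eqxx.
  by cbn [has all andb]; rewrite rd //= mv //= el' er' !eqxx.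
- move=> [el er].
  have [fb [m mN pm]] := two _ _ _ _ _ _ el er l'N rN.
  exists (m + 0).+1; first lia.
  apply: (prf_rule _ _ pm top); first by split.
  rewrite /=; apply/has_input_symbols; exists x; rewrite -tr /shift_clause !eqxx.
  by cbn [has all andb]; rewrite rd //= mv //= !eqxx.
Qed.

(** [rest] is the output still to be parsed. The bound is on m + 1 so that it adds up under the
    binary rule, which costs one more than its premises. *)
Lemma prf_parse q y : cnf bin lett q y -> forall t s rest, t <= t_end ->
  key_state t = Some s -> y ++ rest = pmap out (iota t (t_end.+1 - t)) ->
  exists t' m, [/\ t < t' <= t_end.+1, rest = pmap out (iota t' (t_end.+1 - t')),
    m.+1 <= (t' - t) * (2 * N + 4) &
    prv (TParse q s (key_state t')) (key_fields t ++ key_fields t') m].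
Proof.
have N0 := N_gt0.
have z : is_fields N [:: 0; 0; 0; 0; 0; 0] by rewrite /is_fields /= N0.
have top := prf_top tm_horn w z.
have chain t1 t2 t3 : all (atom_sem w ((key_fields t1 ++ key_fields t3) ++
    (key_fields t1 ++ key_fields t2) ++ (key_fields t2 ++ key_fields t3))) chain_clause.
  case: (key_fields t1) (size_key_fields t1) => [|? [|? [|? []]]] // _.
  case: (key_fields t2) (size_key_fields t2) => [|? [|? [|? []]]] // _.
  case: (key_fields t3) (size_key_fields t3) => [|? [|? [|? []]]] // _.
  by rewrite /= !eqxx.
have same t1 t2 : all (atom_sem w ((key_fields t1 ++ key_fields t2) ++
    (key_fields t1 ++ key_fields t2) ++ [:: 0; 0; 0; 0; 0; 0])) [seq Eq A i (6 + i) | i <- iota 0 6].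
  case: (key_fields t1) (size_key_fields t1) => [|? [|? [|? []]]] // _.
  case: (key_fields t2) (size_key_fields t2) => [|? [|? [|? []]]] // _.
  by rewrite /= !eqxx.
have fk := is_fields_key.
elim=> {q y} [q c lq|q q1 q2 y1 y2 bq c1 IH1 c2 IH2] t s rest tle ks e.
  (* Inner induction on the remaining time, to pass the silent steps before the letter. *)
  have [l] := ubnP (t_end - t); elim: l t s tle ks e => // l IH t s tle ks e tl.
  have [m mN pm] := prf_step tle ks.
  rewrite subSn //= in e; case eo : (out t) e => [o|] /= => [[ec er]|e].
    exists t.+1, (m + 0).+1; split=> //; first by rewrite ltnSn ltnS.
      by rewrite subSnn mul1n; lia.
    apply: (prf_rule _ _ pm top); first by split.
    by rewrite eo -ec [clauses _ _ _]/= lq !eqxx has_seq1 same.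
  have lt : t < t_end.
    by rewrite ltn_neqAle tle andbT; apply/eqP => et; move: eo; rewrite et /out ltnn.
  have [s1 ks1] : exists s1, key_state t.+1 = Some s1 by rewrite /key_state lt; eexists.
  have [||t' [m' [/andP[tt' t'e] er mm' pm']]] := IH t.+1 s1 lt ks1.
  - by rewrite subSS.
  - by lia.
  exists t', (m + m').+1; split=> //; first by rewrite (ltn_trans _ tt').
    rewrite (_ : t' - t = (t' - t.+1).+1); last by lia.
    by rewrite mulSn; lia.
  rewrite ks1 in pm; apply: (prf_rule _ _ pm pm'); first by split.
  by rewrite eo [clauses _ _ _]/= !eqxx has_seq1 chain.
rewrite -catA in e; have [t1 [m1 [/andP[tt1 t1e] e1 mm1 pm1]]] := IH1 t s _ tle ks e.
(* The second factor is nonempty, so some output remains after the first. *)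
have t1le : t1 <= t_end.
  rewrite -ltnS ltn_neqAle t1e andbT; apply/eqP => et; move: e1; rewrite et subnn.
  by move/(congr1 size); rewrite size_cat /=; have := cnf_gt0 c2; lia.
have [s1 ks1] : exists s1, key_state t1 = Some s1 by rewrite /key_state t1le; eexists.
have [t2 [m2 [/andP[t12 t2e] e2 mm2 pm2]]] := IH2 t1 s1 _ t1le ks1 e1.
exists t2, (m1 + m2).+1; split=> //; first by rewrite (ltn_trans tt1).
  rewrite (_ : t2 - t = (t1 - t) + (t2 - t1)) ?mulnDl; lia.
rewrite ks1 in pm1; apply: (prf_rule _ _ pm1 pm2); first by split.
by rewrite [clauses _ _ _]/= bq !eqxx has_seq1 chain.
Qed.

Lemma tm_complete : cnf bin lett q0 (rcons (map Some (output (conf t_end))) None) ->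
  exists2 m, m <= t_end.+1 * (2 * N + 4) & prv TRoot (nseq 6 0) m.
Proof.
have N0 := N_gt0.
have z : is_fields N [:: 0; 0; 0; 0; 0; 0] by rewrite /is_fields /= N0.
have top := prf_top tm_horn w z.
have k0 : key_fields 0 = [:: 0; 0; 0] by rewrite /key_fields leq0n /= num_right_blank.
have s0 : key_state 0 = Some (init_state M, blank M) by rewrite /key_state leq0n.
rewrite -pmap_out_end => c.
have [|t' [m [/andP[_ t'e] e mm pm]]] := prf_parse c (rest := [::]) (leq0n _) s0.
  by rewrite cats0 subn0.
(* Before the fictitious time the end marker would still be among the remaining letters. *)
have et : t' = t_end.+1.
  apply/eqP; rewrite eqn_leq t'e ltnNge; apply/negP => t'le.
  have : t' + (t_end - t') = t_end by lia.
  move: e; rewrite subSn // -addn1 iotaD pmap_cat /= => + eq.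
  by rewrite eq /out ltnn /= cats1; case: (pmap _ _).
move: mm pm; rewrite et key_state_end key_fields_end k0 subn0 => mm pm.
exists (m + 0).+1; first by rewrite addn0.
apply: (prf_rule _ _ pm top); first by split.
by rewrite [clauses _ _ _]/= !eqxx has_seq1 /= .
Qed.

Lemma tm_sound m : prv TRoot (nseq 6 0) m ->
  cnf bin lett q0 (rcons (map Some (output (conf t_end))) None).
Proof. by move=> /prf_meaning; rewrite /= -pmap_out_end. Qed.

End Machine.

(** * Polynomial bounds *)

Section HaltingTime.

Variables (A B : finType) (M : transducer A B) (w : seq A) (Sb t_end : nat).
Local Notation conf := (run M w).
Hypothesis work_bound : forall t, work_pos (conf t) <= Sb.
Hypothesis halted : transition w (conf t_end) = None.
Hypothesis running : forall t, t < t_end -> transition w (conf t) <> None.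

(** Tapes are compared only on the cells within reach of the head, which leaves finitely many
    classes. *)
Definition same_config (c c' : config M) :=
  [/\ cstate c = cstate c', input_pos c = input_pos c', work_pos c = work_pos c' &
      forall i, i <= Sb -> work_tape c i = work_tape c' i].

Lemma same_config_transition c c' : work_pos c <= Sb -> same_config c c' ->
  transition w c = transition w c'.
Proof. by move=> cS [e1 e2 e3 e4]; rewrite /transition e1 e2 e4 ?e3 // -e3. Qed.

Lemma same_config_step c c' : work_pos c <= Sb -> same_config c c' ->
  same_config (step w c) (step w c').
Proof.
move=> cS s; rewrite /step -(same_config_transition cS s); case: s => e1 e2 e3 e4.
case: transition => [[[[[q x] di] dw] o]|] //; split; rewrite /= ?e2 ?e3 // => i iS.
by rewrite e4.
Qed.

(* A machine that halts does not repeat a configuration. *)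
Lemma halting_time_lt :
  t_end < #|state M| * (size w).+2 * Sb.+1 * #|work_symbol M| ^ Sb.+1.
Proof.
pose F (t : 'I_t_end.+1) := (cstate (conf t), inord (input_pos (conf t)) : 'I_(size w).+2,
  inord (work_pos (conf t)) : 'I_Sb.+1, [ffun i : 'I_Sb.+1 => work_tape (conf t) i]).
suff /leq_card : injective F.
  by rewrite !card_prod !card_ord card_ffun card_ord.
suff h t1 t2 : t1 < t2 <= t_end -> same_config (conf t1) (conf t2) -> False.
  have same t1 t2 : F t1 = F t2 -> same_config (conf t1) (conf t2).
    case=> e1 /(congr1 val) e2 /(congr1 val) e3 /ffunP e4.
    rewrite /= !inordK ?ltnS ?input_pos_le ?work_bound // in e2 e3.
    by split=> // i iS; have := e4 (inord i); rewrite !ffunE inordK.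
  move=> t1 t2 e; apply/val_inj; case: (ltngtP t1 t2) => // lt.
    by case: (h t1 t2); rewrite ?lt -1?ltnS ?ltn_ord //; exact: same.
  by case: (h t2 t1); rewrite ?lt -1?ltnS ?ltn_ord //; apply: same.
move=> /andP[t12 t2e] s.
have {}s j : same_config (conf (t1 + j)) (conf (t2 + j)).
  elim: j => [|j IH]; first by rewrite !addn0.
  by rewrite !addnS; exact: same_config_step (work_bound _) IH.
have := same_config_transition (work_bound _) (s (t_end - t2)).
by rewrite subnKC // halted => /running; apply; lia.
Qed.

End HaltingTime.

Lemma halting_run (A B : finType) (M : transducer A B) (w : seq A) t :
  transition w (run M w t) = None ->
  exists t0, [/\ transition w (run M w t0) = None,
    forall t', t' < t0 -> transition w (run M w t') <> None & run M w t0 = run M w t].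
Proof.
move=> ht; have ex : exists t', ~~ isSome (transition w (run M w t')) by exists t; rewrite ht.
case: (ex_minnP ex) => t0; case e : (transition w (run M w t0)) => // _ min.
exists t0; split=> //.
  by move=> t' lt e'; have := min t'; rewrite e' leqNgt lt => /(_ isT).
have t0t : t0 <= t by apply: min; rewrite ht.
rewrite -(subnK t0t); elim: (t - t0) => // j IH.
by rewrite addSn /run iterS -/(run M w (j + t0)) -IH /step e.
Qed.

(** From b <= 2 ^ b and 2 ^ l <= n; the factor 2 absorbs l + 1 <= 2 l, valid as n > 1 gives l >
    0. *)
Lemma log_space_poly b c n : 1 < n ->
  b ^ (c * (trunc_log 2 n).+1) <= n ^ (2 * b * c).
Proof.
move=> n1; set l := trunc_log 2 n.
have l1 : 0 < l by rewrite trunc_log_gt0.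
have ln : 2 ^ l <= n by apply: trunc_logP => //; exact: ltnW.
apply: (@leq_trans ((2 ^ b) ^ (c * l.+1))).
  by case: (c * _) => // j; rewrite leq_exp2r // ltnW // ltn_expl.
apply: (@leq_trans ((2 ^ l) ^ (2 * b * c))); last first.
  by case: (2 * b * c) => // j; rewrite leq_exp2r.
rewrite -!expnM leq_exp2l //.
by have := leq_mul (leqnn (b * c)) (_ : l.+1 <= 2 * l); lia.
Qed.

Lemma leq_self_expn n a : 1 < n -> a <= n ^ a.
Proof. by move=> n1; apply: ltnW; exact: ltn_expl. Qed.

(** The exponent is a sum over the factors: q for the states, 2 for n + 2, k for s + 1, k + g + 1
    for the tape contents, and k + 4 for the cost of one unit of time with N = n ^ (k + 2). *)
Lemma cost_bound q g c n t (k := 2 * g.+1 * c) (s := c * (trunc_log 2 n).+1) :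
  1 < n -> t < q * n.+2 * s.+1 * g ^ s.+1 ->
  t.+1 * (2 * n ^ k.+2 + 4) <= n ^ (q + 2 + k + (k + g.+1) + (k.+2 + 2)).
Proof.
move=> n1; have bs : g.+1 ^ s <= n ^ k := log_space_poly _ _ n1.
clearbody k s => tlt; rewrite expnD; apply: leq_mul.
  apply: leq_trans (tlt) _; rewrite !expnD.
  apply: leq_mul; first apply: leq_mul; first apply: leq_mul.
  - exact: leq_self_expn.
  - by rewrite expnS expn1; nia.
  (* For g = 0 the bound on t is 0, which is absurd; otherwise s is less than a power with exponent
     s. *)
  - case: g tlt bs => [|g] tlt bs; first by move: tlt; rewrite exp0n // muln0.
    exact: leq_trans (ltn_expl s _) bs.
  - rewrite -expnD; apply: (@leq_trans (g.+1 ^ s.+1)).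
      by rewrite leq_exp2r // leqnSn.
    rewrite expnSr expnD; apply: leq_mul bs _.
    exact: leq_self_expn.
have : 4 <= n ^ k.+2.
  by apply: (@leq_trans (2 ^ 2)) => //; apply: (@leq_trans (n ^ 2)); rewrite ?leq_exp2r ?leq_exp2l.
have : 4 <= n ^ 2 by apply: (@leq_trans (2 ^ 2)) => //; rewrite leq_exp2r.
rewrite expnD; move: (n ^ k.+2) (n ^ 2) => x y; nia.
Qed.

Theorem theorem12 :
  exists G : groupoid,
    forall (A : finType) (L : language A), LOGCFL L -> in_QFO G L.
Proof.
exists the_groupoid => A L [B [K [f [/context_free_cnf[Q [q0 [bin [lett KE]]]]
  [M [fM [c space]]] LK]]]].
pose k1 := 2 * #|work_symbol M|.+1 * c.
pose d := #|state M| + 2 + k1 + (k1 + #|work_symbol M|.+1) + (k1.+2 + 2).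
have run_end w : exists t, [/\ transition w (run M w t) = None,
    forall t', t' < t -> transition w (run M w t') <> None & output (run M w t) = f w].
  have [t [ht <-]] := fM w; have [t0 [h1 h2 h3]] := halting_run ht.
  by exists t0; rewrite h3.
have LE w : L w <-> cnf bin lett q0 (rcons (map Some (f w)) None).
  by split=> [/LK/KE|/KE/LK].
(* The two extra factors n leave room for the head positions 0, ..., n + 1 even when k1 = 0. *)
have bn (w : seq A) : 1 < size w -> (size w).+1 < size w ^ k1.+2.
  move=> n1; apply: (@leq_trans (size w ^ 2)); last by rewrite leq_exp2l.
  by rewrite expnS expn1; nia.
have bS (w : seq A) : 1 < size w ->
    #|work_symbol M|.+1 ^ (c * (trunc_log 2 (size w)).+1) <= size w ^ k1.+2.
  move=> n1; apply: leq_trans (log_space_poly _ _ n1) _.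
  by rewrite leq_exp2l // ltnW.
apply: (@horn_in_QFO A L (tm_horn M q0 bin lett) k1.+1 d) => [w n1 Lw|w m n1].
  have [t [h1 h2 h3]] := run_end w.
  have cw : cnf bin lett q0 (rcons (map Some (output (run M w t))) None).
    by rewrite h3; exact/LE.
  have [m mm pm] := tm_complete (space w) h1 h2 (bn w n1) (bS w n1) cw.
  exists m => //.
  exact: leq_trans mm (cost_bound n1 (halting_time_lt (space w) h1 h2)).
have [t [h1 h2 h3]] := run_end w.
move=> /(tm_sound (space w) h1 h2 (bn w n1) (bS w n1)); rewrite h3.
by move=> cw; apply/LE.
Qed.
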